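(* Let $c\ge0$ and $\gamma\in\mathbb{R}$ be such that $|S(t)|_{L_c(C_{cn},C_{cn})}\le c\,e^{\gamma t}$ for all $t\ge0$. Then for each $j\in\{1,\ldots,n\}$ and for all $t\ge0$ we have $$|X_j(t)|\le c\,e^{\gamma t}.$$
   Context: Let $n\in\mathbb{N}$, $h>0$, $I=[-h,0]$. $|\cdot|$ denotes a norm on $\mathbb{C}^n$. $C_c$ is the space of continuous functions $I\to\mathbb{C}$ and $C_{cn}$ the Banach space of continuous maps $I\to\mathbb{C}^n$, with $|\phi|=\max_{t\in I}|\phi(t)|$. For a map $v$ on $M\subset\mathbb{R}$ and $t$ with $[t-h,t]\subset M$, the segment $v_t$ is the map on $I$ given by $v_t(s)=v(t+s)$. A map $w:J\to X$ from an interval $J\subset\mathbb{R}$ into a normed linear space $X$ over $\mathbb{C}$ has property (A) if it is the (everywhere) pointwise limit of a sequence of continuous maps $w_m:J\to X$ with $\sup_{m,t}|w_m(t)|<\infty$. $B_{nA}$ is the space of maps $I\to\mathbb{C}^n$ whose components have property (A), normed by $|\phi|=\sup_{t\in I}|\phi(t)|$. For normed linear spaces $X,Y$ over $\mathbb{C}$, $L_c(X,Y)$ is the space of continuous linear maps $X\to Y$ with the operator norm $|T|=\sup_{|x|=1}|Tx|$, $X^{\ast}=L_c(X,\mathbb{C})$, and $\iota:X\to X^{\ast\ast}$ is given by $\iota(x)x^{\ast}=x^{\ast}x$. Extensions. For $\lambda\in C_{cn}^{\ast}$ and $k=1,\dots,n$ let $E_k:C_c\to C_{cn}$ be the embedding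 into the $k$-th component (the $k$-th component of $E_k\chi$ is $\chi$, all others are $0$), and let $\mu_k$ be the unique complex Borel measure on $I$ with $|\mu_k|$ regular and $\lambda(E_k\chi)=\int\chi\,d\mu_k$ for all $\chi\in C_c$ (Riesz). Set $\lambda_e\phi=\sum_{k=1}^n\int\phi_k\,d\mu_k$ for maps $\phi:I\to\mathbb{C}^n$ whose components $\phi_k$ are bounded Borel functions. For a normed linear space $Y$ over $\mathbb{C}$ and $\Lambda\in L_c(C_{cn},Y)$, the map $\Lambda_E:B_{nA}\to Y^{\ast\ast}$ is given by $(\Lambda_E\phi)y^{\ast}=(y^{\ast}\circ\Lambda)_e\phi$. Weak-star integral. $m$ is Lebesgue measure on $\mathbb{R}$. For an interval $J$ and $F:J\to Y^{\ast\ast}$, the weak-star integral $\int_JF\,dm$ exists if $t\mapsto F(t)y^{\ast}$ is Lebesgue-integrable on $J$ for every $y^{\ast}\in Y^{\ast}$; then $\left(\int_JF\,dm\right)y^{\ast}=\int_JF(t)y^{\ast}\,dm(t)$. Standing assumption: $L,R\in L_c(C_{cn},\mathbb{C}^n)$, and ($\Delta$): there is $\Delta\in(0,h)$ with $L\phi=0$ for all $\phi\in C_{cn}$ with $\phi(t)=0$ on $[-h,-\Delta]$. Semigroup. For each $\phi\in C_{cn}$ there is a unique continuous $v=v^{\phi}:[-h,\infty)\to\mathbb{C}^n$ with $v_0=\phi$ such that $[0,\infty)\ni t\mapsto v(t)-Lv_t$ is differentiable with $\frac{d}{dt}(v(t)-Lv_t)=Rv_t$ for all $t\ge0$. The maps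 $S(t):C_{cn}\to C_{cn}$, $S(t)\phi=v^{\phi}_t$, $t\ge0$, are continuous and linear and form a strongly continuous semigroup. Fundamental solution. For each $\phi\in B_{nA}$ there is a unique map $y=y^{\phi}:[-h,\infty)\to\mathbb{C}^n$ with $y_0=\phi$ such that all restrictions of $y$ to compact intervals and all segments $y_s$, $s\ge0$, have property (A), all weak-star integrals $\int_{(0,t)}R_Ey_s\,dm(s)$, $t>0$, exist, and $\iota(y(t))-L_Ey_t=\iota(\phi(0))-L_E\phi+\int_{(0,t)}R_Ey_s\,dm(s)$ for all $t>0$. For $j\in\{1,\dots,n\}$ let $\phi_j:I\to\mathbb{C}^n$ be given by $\phi_j(t)=0$ on $[-h,0)$ and $\phi_j(0)=e_j$, the $j$-th standard basis vector of $\mathbb{C}^n$ (so $\phi_j\in B_{nA}$). Then $X_j:\mathbb{R}\to\mathbb{C}^n$ is defined by $X_j(t)=0$ for $t<0$ and $X_j(t)=y^{\phi_j}(t)$ for $t\ge0$; the $X_j$ are the columns of the fundamental solution.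
   Formalization: The formal theorem assumes |e_j| ≤ 1 for the index j considered; without this the claim fails for an arbitrary norm on C^n (L = R = 0, c = 1, γ = 0 gives X_j(t) = e_j, so |X_j(t)| = |e_j| may exceed 1). *)

(* Defs.v *)
From HB Require Import structures.
From mathcomp Require Import all_boot all_order all_algebra.
From mathcomp Require Import all_classical all_reals all_analysis.
From mathcomp Require Import complex.

Set Implicit Arguments.
Unset Strict Implicit.
Unset Printing Implicit Defensive.

Import Order.TTheory GRing.Theory Num.Theory.
Import numFieldNormedType.Exports.

Local Open Scope classical_set_scope.
Local Open Scope complex_scope.
Local Open Scope ring_scope.

HB.instance Definition _ (R : realType) := NormedModule.copy R[i] (R[i]^o).

(* Norms of normed modules over R[i] take their values in R[i]; rnorm is the
   same norm read as a real number. *)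
Definition rnorm (R : realType) (V : normedModType R[i]) (x : V) : R :=
  complex.Re `|x|.

Section rnorm_theory.
Context (R : realType) (V : normedModType R[i]).
Implicit Types x y : V.

Lemma rnormE x : (rnorm x)%:C = `|x|.
Proof. by rewrite /rnorm RRe_real// ger0_real. Qed.

Lemma rnorm_ge0 x : 0 <= rnorm x.
Proof. by rewrite -ler0c rnormE. Qed.

Lemma rnorm0 : rnorm (0 : V) = 0.
Proof. by rewrite /rnorm normr0. Qed.

Lemma rnorm_eq0 x : rnorm x = 0 -> x = 0.
Proof. by move=> x0; apply/normr0_eq0; rewrite -rnormE x0. Qed.

Lemma rnormD x y : rnorm (x + y) <= rnorm x + rnorm y.
Proof. by rewrite -lecR rmorphD/= !rnormE ler_normD. Qed.

Lemma rnormN x : rnorm (- x) = rnorm x.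
Proof. by rewrite /rnorm normrN. Qed.

Lemma rnormZ (a : R[i]) x : rnorm (a *: x) = rnorm a * rnorm x.
Proof. by apply: complexI; rewrite rmorphM/= !rnormE normrZ. Qed.

Lemma rnorm_continuous : continuous (@rnorm R V).
Proof.
move=> x; apply/cvgrPdist_lt => e e0.
have e0' : 0 < e%:C :> R[i] by rewrite ltcR.
near=> y.
have : rnorm (x - y) < e.
  by rewrite -ltcR rnormE; near: y; exact: cvgr_dist_lt.
apply: le_lt_trans; rewrite ler_distl lerBlDr; apply/andP; split.
  by rewrite -{1}(subrK x y) -(rnormN (x - y)) opprB [leRHS]addrC rnormD.
by rewrite -{1}(subrK y x) [leRHS]addrC rnormD.
Unshelve. all: by end_near. Qed.

End rnorm_theory.

Section sup_bounds.
Context (R : realType).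

Lemma sup_le_nneg (E : set R) (M : R) : 0 <= M -> ubound E M -> sup E <= M.
Proof.
move=> M0 EM; have [->|/set0P E0] := eqVneq E set0; first by rewrite sup0.
exact: ge_sup.
Qed.

Lemma sup_nneg (E : set R) :
  (forall x, E x -> 0 <= x) -> has_ubound E -> 0 <= sup E.
Proof.
move=> E0 ubE; have [->|/set0P[x Ex]] := eqVneq E set0; first by rewrite sup0.
exact: le_trans (E0 _ Ex) (ub_le_sup ubE Ex).
Qed.

Lemma seminorm_homogeneous (V : lmodType R[i]) (p : V -> R) :
  (forall x, 0 <= p x) -> (forall (a : R[i]) x, p (a *: x) <= rnorm a * p x) ->
  forall (a : R[i]) x, p (a *: x) = rnorm a * p x.
Proof.
move=> p0 pZ a x; apply/eqP; rewrite eq_le pZ/=.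
have [->|a0] := eqVneq a 0; first by rewrite rnorm0 mul0r.
have ra0 : 0 < rnorm a by rewrite -ltcR rnormE normr_gt0.
rewrite -ler_pdivlMl// -[in leLHS](scalerK a0 x).
apply: le_trans (pZ _ _) _; rewrite ler_wpM2r//.
by rewrite -lecR rnormE normfV fmorphV/= rnormE.
Qed.

End sup_bounds.

Section normed_Cn.
Context (R : realType) (n : nat).

Record vnorm := Vnorm {
  vnorm_fun :> 'cV[R[i]]_n -> R ;
  vnormD : forall x y, vnorm_fun (x + y) <= vnorm_fun x + vnorm_fun y ;
  vnormZ : forall (a : R[i]) x, vnorm_fun (a *: x) = rnorm a * vnorm_fun x ;
  vnorm_eq0 : forall x, vnorm_fun x = 0 -> x = 0 }.

Definition Cn (N : vnorm) : Type := 'cV[R[i]]_n.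

Context (N : vnorm).

HB.instance Definition _ := GRing.Lmodule.on (Cn N).

Let norm (x : Cn N) : R[i] := (N x)%:C.

Let normD x y : norm (x + y) <= norm x + norm y.
Proof. by rewrite /norm -rmorphD lecR vnormD. Qed.

Let normZ (a : R[i]) x : norm (a *: x) = `|a| * norm x.
Proof. by rewrite /norm vnormZ rmorphM/= rnormE. Qed.

Let norm0_eq0 x : norm x = 0 -> x = 0.
Proof. by move=> /complexI/vnorm_eq0. Qed.

HB.instance Definition _ :=
  Lmodule_isNormed.Build R[i] (Cn N) normD normZ norm0_eq0.

Lemma rnorm_Cn (x : Cn N) : rnorm x = N x.
Proof. by []. Qed.

Definition e_ (k : 'I_n) : Cn N := delta_mx k 0.

End normed_Cn.

Section history_interval.
Context (R : realType).

Definition segI (h : {posnum R}) : Type := set_type `[- h%:num, 0].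

Context (h : {posnum R}).

HB.instance Definition _ := Topological.on (segI h).

Lemma I0_subproof : (0 : R) \in `[- h%:num, 0]%classic.
Proof. by rewrite inE/= in_itv/= lexx oppr_le0 /= ltW. Qed.

Definition I0 : segI h := exist _ 0 I0_subproof.

HB.instance Definition _ := isPointed.Build (segI h) I0.

Definition I_val (s : segI h) : R := \val s.

End history_interval.

Section continuous_functions.
Context (R : realType) (h : {posnum R}) (V : normedModType R[i]).

Definition cts_pred : {pred segI h -> V} := fun f => `[< continuous f >].

Record cts := Cts { cts_val :> segI h -> V ; _ : cts_val \in cts_pred }.

HB.instance Definition _ := [isSub for cts_val].
HB.instance Definition _ := [Choice of cts by <:].

Lemma cts_pred_submod : submod_closed cts_pred.
Proof.
split; first by apply/asboolP => x; exact: (@cst_continuous _ _ (0 : V)).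
move=> a f g /asboolP cf /asboolP cg; apply/asboolP => x.
exact: (cvgD (cvgZ (cvg_cst a) (cf x)) (cg x)).
Qed.

HB.instance Definition _ :=
  GRing.isSubmodClosed.Build _ _ cts_pred cts_pred_submod.
HB.instance Definition _ := [SubChoice_isSubLmodule of cts by <:].

Lemma cts_continuous (f : cts) : continuous f.
Proof. by case: f => f /= /asboolP. Qed.

Lemma cts_ubound (f : cts) : has_ubound (range (fun s => rnorm (f s))).
Proof.
pose g : R -> R := 'valL_(0 : R) (fun s : `[- h%:num, 0]%classic => rnorm (f s)).
have cg : {within `[- h%:num, 0], continuous g}.
  apply/subspace_valL_continuousP' => s.
  apply: (@continuous_comp _ _ _ f (@rnorm R V)); first exact: cts_continuous.
  exact: rnorm_continuous.
have /compact_bounded[M [_ gM]] :=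
  continuous_compact cg (@segment_compact _ _ _).
exists (M + 1) => _ [s _ <-].
have -> : rnorm (f s) = g (I_val s) by rewrite /g /I_val /= oinv_set_val valK.
apply: le_trans (ler_norm _) _; apply: gM; first by rewrite ltrDl.
by exists (I_val s) => //; have := valP s; rewrite inE.
Qed.

Definition cts_rnorm (f : cts) : R := sup (range (fun s => rnorm (f s))).

Lemma cts_rnorm_ub (f : cts) s : rnorm (f s) <= cts_rnorm f.
Proof. by apply: ub_le_sup; [exact: cts_ubound|exists s]. Qed.

Lemma cts_rnorm_ge0 (f : cts) : 0 <= cts_rnorm f.
Proof. exact: le_trans (rnorm_ge0 _) (cts_rnorm_ub f (I0 h)). Qed.

Let norm (f : cts) : R[i] := (cts_rnorm f)%:C.

Let normD f g : norm (f + g) <= norm f + norm g.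
Proof.
rewrite /norm -rmorphD lecR; apply: sup_le_nneg.
  by rewrite addr_ge0// cts_rnorm_ge0.
by move=> _ [s _ <-]; rewrite (le_trans (rnormD _ _))// lerD// cts_rnorm_ub.
Qed.

Let normZ (a : R[i]) f : norm (a *: f) = `|a| * norm f.
Proof.
rewrite /norm -rnormE -rmorphM; congr (_%:C).
apply: seminorm_homogeneous; first exact: cts_rnorm_ge0.
move=> b g; apply: sup_le_nneg; first by rewrite mulr_ge0 ?rnorm_ge0 ?cts_rnorm_ge0.
by move=> _ [s _ <-]; rewrite rnormZ ler_wpM2l ?rnorm_ge0 ?cts_rnorm_ub.
Qed.

Let norm0_eq0 f : norm f = 0 -> f = 0.
Proof.
move=> /complexI f0; apply/val_inj/funext => s /=; apply: rnorm_eq0.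
by apply/eqP; rewrite eq_le rnorm_ge0 -f0 cts_rnorm_ub.
Qed.

HB.instance Definition _ :=
  Lmodule_isNormed.Build R[i] cts normD normZ norm0_eq0.

Lemma rnorm_cts (f : cts) : rnorm f = sup (range (fun s => rnorm (f s))).
Proof. by []. Qed.

End continuous_functions.

Arguments cts_pred {R} h V.

Section continuous_linear_maps.
Context (R : realType) (X Y : normedModType R[i]).

Definition lc_pred : {pred X -> Y} := fun f => `[< linear f /\ continuous f >].

Record lc := Lc { lc_val :> X -> Y ; _ : lc_val \in lc_pred }.

HB.instance Definition _ := [isSub for lc_val].
HB.instance Definition _ := [Choice of lc by <:].

Lemma lc_pred_submod : submod_closed lc_pred.
Proof.
split.
  apply/asboolP; split; last exact: (@cst_continuous _ _ (0 : Y)).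
  by move=> a x y; rewrite scaler0 addr0.
move=> a f g /asboolP[lf cf] /asboolP[lg cg]; apply/asboolP; split.
  have E z : (a *: f + g) z = a *: f z + g z by [].
  by move=> b x y; rewrite !E lf lg !scalerDr !scalerA (mulrC b) addrACA.
by move=> x; exact: (cvgD (cvgZ (cvg_cst a) (cf x)) (cg x)).
Qed.

HB.instance Definition _ :=
  GRing.isSubmodClosed.Build _ _ lc_pred lc_pred_submod.
HB.instance Definition _ := [SubChoice_isSubLmodule of lc by <:].

Lemma lc_linear (f : lc) : linear f.
Proof. by case: f => f /= /asboolP[]. Qed.

HB.instance Definition _ (f : lc) :=
  GRing.isLinear.Build _ _ _ _ (lc_val f) (lc_linear f).

Lemma lc_continuous (f : lc) : continuous f.
Proof. by case: f => f /= /asboolP[]. Qed.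

Definition opnorm (f : lc) : R :=
  sup [set rnorm (f x) | x in [set x | rnorm x = 1]].

Lemma lc_bounded (f : lc) :
  exists2 M : R, 0 <= M & forall x, rnorm (f x) <= M * rnorm x.
Proof.
have /linear_boundedP/pinfty_ex_gt0[M M0 fM] :=
  continuous_linear_bounded 0 (@lc_continuous f 0).
have ME : M = (complex.Re M)%:C by rewrite RRe_real// gtr0_real.
exists (complex.Re M) => [|x]; first by rewrite -ler0c -ME ltW.
by rewrite -lecR rmorphM/= !rnormE -ME; exact: fM.
Qed.

Lemma opnorm_ubound (f : lc) :
  has_ubound [set rnorm (f x) | x in [set x | rnorm x = 1]].
Proof.
have [M _ fM] := lc_bounded f.
by exists M => _ [x /= x1 <-]; rewrite (le_trans (fM _))// x1 mulr1.
Qed.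

Lemma opnorm_ge0 (f : lc) : 0 <= opnorm f.
Proof.
by apply: sup_nneg (opnorm_ubound f) => _ [x _ <-]; exact: rnorm_ge0.
Qed.

Lemma opnorm_ub (f : lc) x : rnorm (f x) <= opnorm f * rnorm x.
Proof.
have [->|x0] := eqVneq x 0; first by rewrite linear0 !rnorm0 mulr0.
have rx0 : 0 < rnorm x by rewrite -ltcR rnormE normr_gt0.
have rV : rnorm ((rnorm x)^-1%:C : R[i]) = (rnorm x)^-1.
  by apply: complexI; rewrite rnormE ger0_norm// ler0c invr_ge0 ltW.
rewrite -ler_pdivrMr// mulrC -rV -rnormZ -linearZ.
apply: (ub_le_sup (opnorm_ubound f)).
by exists ((rnorm x)^-1%:C *: x) => //=; rewrite rnormZ rV mulVf// gt_eqF.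
Qed.

Let norm (f : lc) : R[i] := (opnorm f)%:C.

Let normD f g : norm (f + g) <= norm f + norm g.
Proof.
rewrite /norm -rmorphD lecR; apply: sup_le_nneg.
  by rewrite addr_ge0// opnorm_ge0.
move=> _ [x /= x1 <-]; rewrite (le_trans (rnormD _ _))// lerD//.
  by rewrite (le_trans (opnorm_ub _ _))// x1 mulr1.
by rewrite (le_trans (opnorm_ub _ _))// x1 mulr1.
Qed.

Let normZ (a : R[i]) f : norm (a *: f) = `|a| * norm f.
Proof.
rewrite /norm -rnormE -rmorphM; congr (_%:C).
apply: seminorm_homogeneous; first exact: opnorm_ge0.
move=> b g; apply: sup_le_nneg.
  by rewrite mulr_ge0 ?rnorm_ge0 ?opnorm_ge0.
move=> _ [x /= x1 <-]; rewrite rnormZ ler_wpM2l ?rnorm_ge0//.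
by rewrite (le_trans (opnorm_ub _ _))// x1 mulr1.
Qed.

Let norm0_eq0 f : norm f = 0 -> f = 0.
Proof.
move=> /complexI f0; apply/val_inj/funext => x /=; apply: rnorm_eq0.
apply/eqP; rewrite eq_le rnorm_ge0 andbT.
by rewrite (le_trans (opnorm_ub _ _))// f0 mul0r.
Qed.

HB.instance Definition _ :=
  Lmodule_isNormed.Build R[i] lc normD normZ norm0_eq0.

Lemma rnorm_lc (f : lc) :
  rnorm f = sup [set rnorm (f x) | x in [set x | rnorm x = 1]].
Proof. by []. Qed.

Lemma lc_intro (f : X -> Y) (M : R) : linear f ->
  (forall x, rnorm (f x) <= M * rnorm x) -> f \in lc_pred.
Proof.
move=> lf fM; apply/asboolP; split => //.
pose F : {linear X -> Y} := HB.pack f (GRing.isLinear.Build _ _ _ _ f lf).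
apply: (@bounded_linear_continuous _ _ _ F).
apply/linear_boundedP; near=> r => x.
have r0 : M%:C <= r.
  by near: r; apply: nbhs_pinfty_ge; rewrite complex_real.
rewrite -!rnormE (le_trans _ (ler_wpM2r _ r0)) ?ler0c ?rnorm_ge0//.
by rewrite -rmorphM lecR.
Unshelve. all: by end_near. Qed.

End continuous_linear_maps.

Arguments lc_pred {R} X Y.

Section duality.
Context (R : realType) (X Y Z : normedModType R[i]).

Lemma lc_comp_subproof (g : lc Y Z) (f : lc X Y) : g \o f \in lc_pred X Z.
Proof.
apply/asboolP; split; first by move=> a x y; rewrite /= !linearP.
by move=> x; apply: continuous_comp; exact: lc_continuous.
Qed.

Definition lc_comp (g : lc Y Z) (f : lc X Y) : lc X Z :=
  Lc (lc_comp_subproof g f).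

Definition dual : normedModType R[i] := lc X R[i].

End duality.

Section bidual.
Context (R : realType) (X : normedModType R[i]).

Lemma iota_subproof (x : X) :
  (fun xs : dual X => xs x) \in lc_pred (dual X) R[i].
Proof.
apply: (@lc_intro _ _ _ _ (rnorm x)) => [a f g//|f].
by rewrite mulrC; exact: opnorm_ub.
Qed.

Definition iota (x : X) : dual (dual X) := Lc (iota_subproof x).

End bidual.

Section complex_measures.
Context (d : measure_display) (T : measurableType d) (R : realType).
Implicit Types nu : {charge set T -> \bar R}.

Definition hahn_pos nu : set T := sval (cid (Hahn_decomposition nu)).

Definition hahn_neg nu : set T :=
  sval (cid (svalP (cid (Hahn_decomposition nu)))).

Lemma hahn_posneg nu : hahn_decomposition nu (hahn_pos nu) (hahn_neg nu).
Proof. exact: svalP (cid (svalP (cid (Hahn_decomposition nu)))). Qed.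

(* The positive and negative variations do not depend on the chosen Hahn
   decomposition. *)
Definition charge_integral nu (f : T -> R) : R :=
  \int[jordan_pos (hahn_posneg nu)]_x f x -
  \int[jordan_neg (hahn_posneg nu)]_x f x.

(* A complex measure, given by its real and imaginary parts, which are finite
   signed measures. *)
Record cmeasure := CMeasure {
  cm_Re : {charge set T -> \bar R} ;
  cm_Im : {charge set T -> \bar R} }.

Definition cm_val (mu : cmeasure) (A : set T) : R[i] :=
  fine (cm_Re mu A) +i* fine (cm_Im mu A).

Definition cintegral (mu : cmeasure) (f : T -> R[i]) : R[i] :=
  (charge_integral (cm_Re mu) (fun x => complex.Re (f x)) -
   charge_integral (cm_Im mu) (fun x => complex.Im (f x))) +i*
  (charge_integral (cm_Re mu) (fun x => complex.Im (f x)) +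
   charge_integral (cm_Im mu) (fun x => complex.Re (f x))).

Definition total_variation (mu : cmeasure) (A : set T) : \bar R :=
  ereal_sup [set (\sum_(0 <= i <oo) (rnorm (cm_val mu (E i)))%:E)%E |
    E in [set E : nat -> set T | [/\ forall i, measurable (E i),
                                 trivIset setT E & \bigcup_i E i = A]]].

End complex_measures.

Definition borel (T : ptopologicalType) := g_sigma_algebraType (@open T).

Definition regular_cmeasure (R : realType) (T : ptopologicalType)
    (mu : cmeasure (borel T) R) : Prop :=
  forall A : set (borel T), measurable A ->
    total_variation mu A =
      ereal_inf [set total_variation mu U |
                 U in [set U : set T | open U /\ A `<=` U]] /\
    total_variation mu A =
      ereal_sup [set total_variation mu K |
                 K in [set K : set T | compact K /\ K `<=` A]].

Definition property_A (R : realType) (T : topologicalType)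
    (X : normedModType R[i]) (w : T -> X) : Prop :=
  exists w_ : nat -> T -> X,
    [/\ forall m, continuous (w_ m),
        exists M : R, forall m t, rnorm (w_ m t) <= M &
        forall t, w_ m t @[m --> \oo] --> w t].

Section weak_star_integral.
Context (R : realType) (Y : normedModType R[i]).

(* Integrability here includes Borel measurability of the integrand. It is
   applied to integrals of segments of maps with property (A), which are Borel
   in t. *)
Definition clebesgue_integrable (J : set R) (f : R -> R[i]) : Prop :=
  lebesgue_measure.-integrable J (fun t => (complex.Re (f t))%:E) /\
  lebesgue_measure.-integrable J (fun t => (complex.Im (f t))%:E).

Definition clebesgue_integral (J : set R) (f : R -> R[i]) : R[i] :=
  (\int[lebesgue_measure]_(t in J) complex.Re (f t)) +i*
  (\int[lebesgue_measure]_(t in J) complex.Im (f t)).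

Definition is_weak_star_integral (J : set R) (F : R -> dual (dual Y))
    (G : dual (dual Y)) : Prop :=
  forall ys : dual Y,
    clebesgue_integrable J (fun t => F t ys) /\
    G ys = clebesgue_integral J (fun t => F t ys).

End weak_star_integral.

Section neutral_equation.
Context (R : realType) (n : nat) (h : {posnum R}) (N : vnorm R n).

Local Notation Ccn := (cts h (Cn N)).

Definition component (k : 'I_n) (phi : segI h -> Cn N) : segI h -> R[i] :=
  fun s => (phi s : 'cV[R[i]]_n) k 0.

Lemma E_subproof (k : 'I_n) (chi : cts h R[i]) :
  (fun s => chi s *: e_ N k) \in cts_pred h (Cn N).
Proof.
apply/asboolP => s.
exact: (cvgZ (@cts_continuous _ _ _ chi s) (cvg_cst (e_ N k))).
Qed.

Definition E_ (k : 'I_n) (chi : cts h R[i]) : Ccn := Cts (E_subproof k chi).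

Definition riesz_measures (lambda : dual Ccn)
    (mu : 'I_n -> cmeasure (borel (segI h)) R) : Prop :=
  forall k, regular_cmeasure (mu k) /\
    forall chi : cts h R[i], lambda (E_ k chi) = cintegral (mu k) chi.

Definition in_BnA (phi : segI h -> Cn N) : Prop :=
  forall k, property_A (component k phi).

(* LambdaE is the extension of Lambda to the maps with components of
   property (A); its values on other maps are unconstrained. *)
Definition is_extension (Y : normedModType R[i]) (Lambda : lc Ccn Y)
    (LambdaE : (segI h -> Cn N) -> dual (dual Y)) : Prop :=
  forall ys : dual Y, exists2 mu : 'I_n -> cmeasure (borel (segI h)) R,
    riesz_measures (lc_comp ys Lambda) mu &
    forall phi, in_BnA phi ->
      LambdaE phi ys = \sum_k cintegral (mu k) (component k phi).

(* Maps defined on [-h, +oo[ are represented by maps defined on R, of which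
   only the values on [-h, +oo[ matter. *)
Definition segment (v : R -> Cn N) (t : R) : segI h -> Cn N :=
  fun s => v (t + I_val s).

(* The segment as an element of the space of continuous maps (0 if the segment
   is not continuous). *)
Definition csegment (v : R -> Cn N) (t : R) : Ccn := insubd 0 (segment v t).

Definition has_derivative_within (D : set R) (g : R -> Cn N) (t : R)
    (l : Cn N) : Prop :=
  (s - t)^-1%:C *: (g s - g t) @[s --> within D t^'] --> l.

Definition neutral_solution (L Rop : lc Ccn (Cn N)) (phi : Ccn)
    (v : R -> Cn N) : Prop :=
  [/\ {within `[- h%:num, +oo[, continuous v},
      csegment v 0 = phi &
      forall t, 0 <= t ->
        has_derivative_within `[0, +oo[ (fun s => v s - L (csegment v s)) t
          (Rop (csegment v t))].

Definition solution_semigroup (L Rop : lc Ccn (Cn N))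
    (S : R -> lc Ccn Ccn) : Prop :=
  forall phi, exists2 v, neutral_solution L Rop phi v &
    forall t, 0 <= t -> S t phi = csegment v t.

Definition condition_Delta (L : lc Ccn (Cn N)) : Prop :=
  exists2 Delta : R, 0 < Delta < h%:num &
    forall phi : Ccn,
      (forall s, - h%:num <= I_val s <= - Delta -> phi s = 0) -> L phi = 0.

Definition extended_solution
    (LE RE : (segI h -> Cn N) -> dual (dual (Cn N)))
    (phi : segI h -> Cn N) (y : R -> Cn N) : Prop :=
  [/\ forall s, segment y 0 s = phi s,
      forall a b : R, - h%:num <= a -> a <= b ->
        property_A (fun s : `[a, b]%classic => y (\val s)),
      forall s, 0 <= s -> property_A (segment y s) &
      forall t, 0 < t -> exists2 G : dual (dual (Cn N)),
        is_weak_star_integral `]0, t[ (fun s => RE (segment y s)) G &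
        iota (y t) - LE (segment y t) = iota (phi (I0 h)) - LE phi + G].

Definition phi_ (j : 'I_n) : segI h -> Cn N :=
  fun s => if I_val s == 0 then e_ N j else 0.

Definition fundamental_solution
    (LE RE : (segI h -> Cn N) -> dual (dual (Cn N)))
    (X : 'I_n -> R -> Cn N) : Prop :=
  forall j, exists2 y, extended_solution LE RE (phi_ j) y &
    forall t, X j t = if t < 0 then 0 else y t.

End neutral_equation.

(* Main.v *)
(* Let phi_m = max(0, 1 + m s) e_j, continuous maps of norm at most 1 which
   converge pointwise to phi_j on [-h, 0], and let v_m be the solutions of the
   neutral equation with v_m = phi_m on [-h, 0]. Since v_m(t) = (S(t) phi_m)(0),
   we have |v_m(t)| <= c e^(gamma t), so it suffices that v_m -> X_j pointwise.

   The difference w_m = X_j - v_m solves the extended integrated equation. By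
   Riesz representation and dominated convergence, a pointwise bound K on
   limsup |w_m| over a segment yields the bound C K on limsup |R_E (w_m)_s|.
   Condition (Delta) makes L_E (w_m)_t depend only on the past, so that pointwise
   convergence to 0 propagates from [-h, T] to [-h, T + d] with a fixed d > 0:
   there the integral term turns a bound K on limsup |w_m| into K / 2. *)
Require Import Defs.
From HB Require Import structures.
From mathcomp Require Import all_boot all_order all_algebra.
From mathcomp Require Import all_classical all_reals all_analysis.
From mathcomp Require Import measurable_realfun complex ring lra.

Set Implicit Arguments.
Unset Strict Implicit.
Unset Printing Implicit Defensive.

Import Order.TTheory GRing.Theory Num.Theory.
Import numFieldNormedType.Exports.

Local Open Scope classical_set_scope.
Local Open Scope ring_scope.

(** * Real-valued norms, complex parts and coordinates *)

(** A positive element of [R[i]] is real, so radii in [R[i]] and radii in [R] describe the same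
    convergence. *)
Lemma cvg_rnormP (R : realType) (V : normedModType R[i]) (T : Type)
    (F : set_system T) (FF : Filter F) (f : T -> V) (l : V) :
  f @ F --> l <->
  forall e : R, 0 < e -> \forall x \near F, rnorm (l - f x) < e.
Proof.
split=> [/cvgrPdist_lt fl e e0|fl].
  have e0' : 0 < e%:C%C :> R[i] by rewrite ltcR.
  by near=> x; rewrite -ltcR rnormE; near: x; exact: fl.
apply/cvgrPdist_lt => e e0.
have eE : e = (complex.Re e)%:C%C by rewrite RRe_real// gtr0_real.
have e0' : 0 < complex.Re e by rewrite -ltcR -eE.
by near=> x; rewrite -rnormE eE ltcR; near: x; exact: fl.
Unshelve. all: by end_near. Qed.

Lemma rnorm_complex (R : realType) (z : R[i]) :
  rnorm z = Num.sqrt (complex.Re z ^+ 2 + complex.Im z ^+ 2).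
Proof. by case: z => a b; rewrite /rnorm normc_def. Qed.

Lemma ler_Re_rnorm (R : realType) (z : R[i]) : `|complex.Re z| <= rnorm z.
Proof. by rewrite rnorm_complex -sqrtr_sqr ler_wsqrtr// lerDl sqr_ge0. Qed.

Lemma ler_Im_rnorm (R : realType) (z : R[i]) : `|complex.Im z| <= rnorm z.
Proof. by rewrite rnorm_complex -sqrtr_sqr ler_wsqrtr// lerDr sqr_ge0. Qed.

Lemma ler_rnorm_ReIm (R : realType) (z : R[i]) :
  rnorm z <= `|complex.Re z| + `|complex.Im z|.
Proof.
rewrite rnorm_complex -[leRHS]ger0_norm ?addr_ge0// -sqrtr_sqr ler_wsqrtr//.
rewrite -(real_normK (num_real (complex.Re z))).
rewrite -(real_normK (num_real (complex.Im z))) sqrrD -addrA lerD2l.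
by rewrite lerDr mulrn_wge0// mulr_ge0.
Qed.

Lemma ler_rnorm_sum (R : realType) (V : normedModType R[i]) (I : Type)
    (r : seq I) (P : pred I) (F : I -> V) :
  rnorm (\sum_(i <- r | P i) F i) <= \sum_(i <- r | P i) rnorm (F i).
Proof.
elim/big_ind2: _ => [|x a y b xa yb|//]; first by rewrite rnorm0.
by rewrite (le_trans (rnormD _ _))// lerD.
Qed.

Lemma Cn_eqP (R : realType) (n : nat) (N : vnorm R n) (x y : Cn N) :
  (forall k, (x : 'cV[R[i]]_n) k 0 = (y : 'cV[R[i]]_n) k 0) <-> x = y.
Proof.
split=> [xy|->//].
suff : (x : 'cV[R[i]]_n) = y by [].
by apply/colP => k; exact: xy.
Qed.

Lemma Cn_sum_e (R : realType) (n : nat) (N : vnorm R n) (x : Cn N) :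
  x = \sum_k (x : 'cV[R[i]]_n) k 0 *: e_ N k.
Proof. by rewrite {1}[x]matrix_sum_delta; apply: eq_bigr => k _; rewrite big_ord1. Qed.

Lemma normr_row_le (R : realType) (m : nat) (v : 'rV[R]_m) i : `|v 0 i| <= `|v|.
Proof.
rewrite [leRHS]mx_normrE.
exact: (le_bigmax _ (fun ij : 'I_1 * 'I_m => `|v ij.1 ij.2|) (0, i)).
Qed.

(** * Boundedness of the coordinates for an arbitrary norm on C^n *)

Section coordinate_bound.
Context (R : realType) (n : nat) (N : vnorm R n).

(** Identifies R^(2n) with C^n, real parts first, so that compactness of the unit sphere of real row
    vectors can be used. *)
Let F (v : 'rV[R]_(n + n)) : Cn N :=
  \col_k Complex (v 0 (lshift n k)) (v 0 (rshift n k)).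

Let FB v w : F v - F w = F (v - w).
Proof.
apply/Cn_eqP => i; rewrite !mxE; apply/eqP; rewrite eq_complex /=.
by apply/andP; split; apply/eqP.
Qed.

Let FZ (a : R) v : F (a *: v) = a%:C%C *: F v.
Proof.
apply/Cn_eqP => i; rewrite !mxE; apply/eqP; rewrite eq_complex /=.
by rewrite !mul0r subr0 addr0 !eqxx.
Qed.

Let F_eq0 v : F v = 0 -> v = 0.
Proof.
move=> /Cn_eqP F0; apply/rowP => i; rewrite mxE.
case: (split_ordP i) => k ->; have := F0 k; rewrite !mxE => /eqP.
  by rewrite eq_complex => /andP[/eqP].
by rewrite eq_complex => /andP[_ /eqP].
Qed.

Let F_surj (x : Cn N) : exists v, x = F v.
Proof.
exists (row_mx (\row_k complex.Re ((x : 'cV_n) k 0))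
  (\row_k complex.Im ((x : 'cV_n) k 0))).
apply/Cn_eqP => k; rewrite mxE row_mxEl row_mxEr !mxE.
by case: (x k 0).
Qed.

Let F_le : exists2 C, 0 <= C & forall v, rnorm (F v) <= C * `|v|.
Proof.
exists (\sum_k (2 * rnorm (e_ N k))) => [|v].
  by apply: sumr_ge0 => k _; rewrite mulr_ge0// rnorm_ge0.
rewrite (Cn_sum_e (F v)) (le_trans (ler_rnorm_sum _ _ _))// mulr_suml.
apply: ler_sum => k _; rewrite rnormZ mulrAC ler_wpM2r ?rnorm_ge0//.
rewrite (le_trans (ler_rnorm_ReIm _))// mxE/= mulr_natl mulr2n.
by rewrite lerD// normr_row_le.
Qed.

(** Equivalence of norms: [p] is continuous and positive on the compact unit sphere of the sup norm,
    so it has a positive minimum there, and homogeneity extends the resulting estimate to all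
    vectors. *)
Lemma rnorm_coord : exists2 C : R, 0 <= C &
  forall (x : Cn N) (k : 'I_n), rnorm ((x : 'cV[R[i]]_n) k 0) <= C * rnorm x.
Proof.
have [C0 C00 FC0] := F_le.
pose p v := rnorm (F v).
have cp : continuous p.
  move=> v; apply: (@continuous_comp _ _ _ F (@rnorm R _)); last exact: rnorm_continuous.
  apply/(@cvg_rnormP R _ _ (nbhs v)) => e e0; near=> w.
  rewrite FB (le_lt_trans (FC0 _))//.
  apply: (@le_lt_trans _ _ ((C0 + 1) * `|v - w|)).
    by rewrite ler_wpM2r// lerDl.
  rewrite -ltr_pdivlMl ?ltr_wpDl//; near: w; apply: cvgr_dist_lt => //.
  by rewrite mulr_gt0// invr_gt0 ltr_wpDl.
pose S := [set v : 'rV[R]_(n + n) | `|v| = 1].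
have SV v : v != 0 -> S (`|v|^-1 *: v).
  by move=> v0; rewrite /S/= normrZ normfV normr_id mulVf// normr_eq0.
(* An empty sphere occurs for [n = 0]; every [v] is then 0. *)
have [S0|S0] := pselect (S !=set0); last first.
  exists 0 => // x k; have [v ->] := F_surj x; rewrite mul0r.
  have [->|/SV Sv] := eqVneq v 0.
    by rewrite !mxE/= -[Complex 0 0]/(0 : R[i]) rnorm0.
  by exfalso; apply: S0; eexists; exact: Sv.
have cS : compact S.
  apply: bounded_closed_compact.
    by exists 1; split => // x x1 v /= ->; exact: ltW.
  rewrite (_ : S = (fun v : 'rV[R]_(n + n) => `|v|) @^-1` [set 1])//.
  apply: closed_comp => [v _|]; first exact: norm_continuous.
  exact: closed_eq.
have [c Sc cmin] := EVT_min_rV S0 cS (continuous_subspaceT cp).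
have pc0 : 0 < p c.
  rewrite lt_neqAle rnorm_ge0 andbT eq_sym; apply/eqP => /rnorm_eq0/F_eq0 c0.
  move: Sc; rewrite inE /S/= c0 normr0 => /eqP.
  by rewrite eq_sym oner_eq0.
(* The factor 2 comes from bounding a modulus by the sum of the absolute values of its real and
   imaginary parts. *)
exists (2 / p c) => [|x k]; first by rewrite divr_ge0// ltW.
have [v ->] := F_surj x.
have vp : `|v| <= (p c)^-1 * rnorm (F v).
  have [->|v0] := eqVneq v 0; first by rewrite normr0 mulr_ge0 ?rnorm_ge0// invr_ge0 ltW.
  rewrite ler_pdivlMl// mulrC.
  have := cmin _ (mem_set (SV _ v0)).
  rewrite {2}/p FZ rnormZ.
  have -> : rnorm ((`|v|^-1)%:C%C : R[i]) = `|v|^-1.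
    by apply: complexI; rewrite rnormE ger0_norm// ler0c.
  by rewrite ler_pdivlMl// normr_gt0.
rewrite -mulrA (le_trans _ (ler_wpM2l _ vp))//.
rewrite (le_trans (ler_rnorm_ReIm _))// mxE/= mulr_natl mulr2n.
by rewrite lerD// normr_row_le.
Unshelve. all: by end_near. Qed.

End coordinate_bound.

(** * Bounds on limits superior *)

(** An epsilon form of limsup |u m| <= K. Convergence to 0 is the case [K = 0]; general [K] is kept
    because the main estimate improves such a bound by iteration. *)
Definition limsup_norm_le (R : realType) (u : nat -> R) (K : R) : Prop :=
  forall e, 0 < e -> \forall m \near \oo, `|u m| <= K + e.

Section limsup_norm_le_theory.
Context (R : realType).
Implicit Types (u v : nat -> R) (K : R).

Lemma limsup_norm_leW u v K : (forall m, `|u m| <= `|v m|) ->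
  limsup_norm_le v K -> limsup_norm_le u K.
Proof.
move=> uv vK e e0; near=> m; apply: le_trans (uv m) _.
by near: m; exact: vK.
Unshelve. all: by end_near. Qed.

Lemma limsup_norm_le_wr u K K' : K <= K' ->
  limsup_norm_le u K -> limsup_norm_le u K'.
Proof.
move=> KK uK e e0; near=> m; apply: (@le_trans _ _ (K + e)); last by rewrite lerD2r.
by near: m; exact: uK.
Unshelve. all: by end_near. Qed.

Lemma limsup_norm_leD u v K K' : limsup_norm_le u K -> limsup_norm_le v K' ->
  limsup_norm_le (fun m => u m + v m) (K + K').
Proof.
move=> uK vK e e0; have e2 : 0 < e / 2 by rewrite divr_gt0.
near=> m; rewrite (le_trans (ler_normD _ _))// [e in leRHS]splitr addrACA lerD//.
  by near: m; exact: uK.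
by near: m; exact: vK.
Unshelve. all: by end_near. Qed.

Lemma limsup_norm_leN u K : limsup_norm_le u K ->
  limsup_norm_le (fun m => - u m) K.
Proof. by apply: limsup_norm_leW => m; rewrite normrN. Qed.

Lemma limsup_norm_leB u v K K' : limsup_norm_le u K -> limsup_norm_le v K' ->
  limsup_norm_le (fun m => u m - v m) (K + K').
Proof. by move=> uK /limsup_norm_leN; exact: limsup_norm_leD. Qed.

Lemma limsup_norm_le_sum (I : finType) (u : I -> nat -> R) (K : I -> R) :
  (forall i, limsup_norm_le (u i) (K i)) ->
  limsup_norm_le (fun m => \sum_i u i m) (\sum_i K i).
Proof.
move=> uK; elim: index_enum => [|i r IH].
  move=> e e0; near=> m; rewrite !big_nil normr0 add0r; exact: ltW.
rewrite (_ : (fun m => _) = fun m => u i m + \sum_(j <- r) u j m).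
  by rewrite big_cons; exact: limsup_norm_leD.
by apply/funext => m; rewrite big_cons.
Unshelve. all: by end_near. Qed.

Lemma limsup_norm_leZ u K a : 0 <= a -> limsup_norm_le u K ->
  limsup_norm_le (fun m => a * u m) (a * K).
Proof.
move=> a0 uK e e0; have e1 : 0 < e / (a + 1) by rewrite divr_gt0// ltr_wpDl.
near=> m; rewrite normrM (ger0_norm a0).
apply: (@le_trans _ _ (a * (K + e / (a + 1)))).
  by rewrite ler_wpM2l//; near: m; exact: uK.
rewrite mulrDr lerD2l mulrA ler_pdivrMr ?ltr_wpDl// mulrC.
by rewrite ler_wpM2l ?lerDl// ltW.
Unshelve. all: by end_near. Qed.

Lemma limsup_norm_le0P u : limsup_norm_le u 0 <-> u @ \oo --> (0 : R).
Proof.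
split=> [u0|/cvgr0Pnorm_le u0 e e0].
  apply/cvgr0Pnorm_le => e e0; near=> m; rewrite -[e]add0r.
  by near: m; exact: u0.
by near=> m; rewrite add0r; near: m; exact: u0.
Unshelve. all: by end_near. Qed.

Lemma limsup_norm_le_cst u K (x : R) : limsup_norm_le u K ->
  (forall m, x <= `|u m|) -> x <= K.
Proof.
move=> uK xu; apply/ler_addgt0Pr => e e0.
have [m _ /(_ m (leqnn _))] := uK _ e0.
by apply: le_trans.
Qed.

(** Closes an iteration in which each round halves the bound. *)
Lemma limsup_norm_le_inf u K0 : (forall k, limsup_norm_le u (K0 / 2 ^+ k)) ->
  limsup_norm_le u 0.
Proof.
move=> uK e e0; have e2 : 0 < e / 2 by rewrite divr_gt0.
have [k Kk] : exists k, K0 / 2 ^+ k <= e / 2.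
  have /cvgr0Pnorm_le/(_ _ e2)[k _ /(_ k (leqnn _))] :
      (fun k => K0 / 2 ^+ k) @ \oo --> (0 : R).
    rewrite -[X in _ --> X](mulr0 K0); apply: cvgM; first exact: cvg_cst.
    under eq_fun do rewrite -exprVn.
    by apply: cvg_expr; rewrite ger0_norm// invf_lt1// ltr1n.
  by move=> H; exists k; rewrite (le_trans (ler_norm _)).
near=> m; rewrite add0r (@le_trans _ _ (K0 / 2 ^+ k + e / 2))//.
  by near: m; exact: uK.
by rewrite [leRHS]splitr lerD2r.
Unshelve. all: by end_near. Qed.

(** Since |f m| <= K + max(|f m| - K, 0), only the excess over [K] matters. It is bounded and tends
    to 0 pointwise, so by dominated convergence its integral over the finite measure tends to 0. *)
Lemma limsup_norm_le_Rintegral d (T : measurableType d)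
    (mu : {measure set T -> \bar R}) (D : set T) (f : nat -> T -> R) (M K : R) :
  measurable D -> (mu D < +oo)%E -> 0 <= K ->
  (forall m, measurable_fun D (f m)) ->
  (forall m x, D x -> `|f m x| <= M) ->
  (forall x, D x -> limsup_norm_le (f^~ x) K) ->
  limsup_norm_le (fun m => \int[mu]_(x in D) f m x) (K * fine (mu D)).
Proof.
move=> mD muD K0 mf fM fK.
have bdd (g : T -> R) (C : R) : measurable_fun D g ->
    (forall x, D x -> `|g x| <= C) -> mu.-integrable D (EFin \o g).
  move=> mg gC; apply: measurable_bounded_integrable => //.
  exists C; split; first exact: num_real.
  by move=> C' CC' x /gC /le_trans; apply; exact: ltW.
pose g m x := Num.max (`|f m x| - K) 0.
have mnf m : measurable_fun D (fun x => `|f m x|) by exact: measurableT_comp.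
have mg m : measurable_fun D (g m).
  by apply: measurable_maxr => //; apply: measurable_funB.
have g_bd m x : D x -> `|g m x| <= `|M|.
  move=> Dx; rewrite ger0_norm ?le_max ?lexx ?orbT// ge_max normr_ge0 andbT.
  rewrite lerBlDr (le_trans (fM _ _ Dx))// (le_trans (ler_norm _))// lerDl//.
have ig m : mu.-integrable D (EFin \o g m) by apply: bdd (mg m) (g_bd m).
have g0 : (fun m => \int[mu]_(x in D) g m x) @ \oo --> (0 : R).
  have -> : 0 = fine (\int[mu]_(x in D) (cst 0%:E) x) by rewrite integral_cst// mul0e.
  apply: fine_cvg; rewrite fineK; last by rewrite integral_cst// mul0e.
  apply: (@dominated_cvg _ _ _ _ _ _ _ _ (cst `|M|%:E)) => //.
  - by move=> m; apply/measurable_EFinP.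
  - move=> x Dx; apply/fine_cvgP; split; first exact: nearW.
    apply/cvgr0Pnorm_le => e e0; near=> m.
    rewrite /= ger0_norm ?le_max ?lexx ?orbT// ge_max (ltW e0) andbT lerBlDl.
    by near: m; exact: fK.
  - by apply: (bdd (cst `|M|) `|M|) => // x _; rewrite normr_id.
move=> e e0; near=> m.
rewrite (le_trans (le_normr_Rintegral _ _))//; first exact: bdd (mf m) (fM m).
apply: (@le_trans _ _ (\int[mu]_(x in D) (K + g m x))).
  apply: le_Rintegral => //.
  - by apply: (bdd _ M) => // x Dx; rewrite normr_id fM.
  - apply: (bdd _ (K + `|M|)); first exact: measurable_funD.
    by move=> x Dx; rewrite (le_trans (ler_normD _ _))// lerD// ?g_bd// ger0_norm.
  - by move=> x Dx; rewrite -lerBlDl le_max lexx.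
rewrite RintegralD//; last by apply: (bdd (cst K) K) => // x _; rewrite /= ger0_norm.
rewrite Rintegral_cst// lerD2l (le_trans (ler_norm _))//.
by near: m; move/cvgr0Pnorm_le : g0; exact.
Unshelve. all: by end_near. Qed.

End limsup_norm_le_theory.

(** * Integration against signed and complex measures *)

Section cintegral_theory.
Context d (T : measurableType d) (R : realType).
Implicit Types (nu : {charge set T -> \bar R}) (mu : cmeasure T R).

Definition bounded_measurable (f : T -> R[i]) : Prop :=
  [/\ measurable_fun setT (fun x => complex.Re (f x)),
      measurable_fun setT (fun x => complex.Im (f x)) &
      exists M : R, forall x, rnorm (f x) <= M].

Lemma bounded_integrable (m : {finite_measure set T -> \bar R}) (f : T -> R)
    (M : R) : measurable_fun setT f -> (forall x, `|f x| <= M) ->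
  m.-integrable setT (EFin \o f).
Proof.
move=> mf fM; apply: measurable_bounded_integrable => //.
  exact: fin_num_fun_lty (fin_num_measure m).
exists M; split; first exact: num_real.
by move=> C MC x _; rewrite /= (le_trans (fM x))// ltW.
Qed.

Lemma charge_integralB nu (f g : T -> R) (M : R) :
  measurable_fun setT f -> measurable_fun setT g ->
  (forall x, `|f x| <= M) -> (forall x, `|g x| <= M) ->
  charge_integral nu (fun x => f x - g x) =
    charge_integral nu f - charge_integral nu g.
Proof.
move=> mf mg fM gM; rewrite /charge_integral.
rewrite !RintegralB//;
  try by [exact: bounded_integrable fM|exact: bounded_integrable gM].
by ring.
Qed.

Lemma limsup_charge_integral nu : exists2 C : R, 0 <= C &
  forall (f : nat -> T -> R) (M K : R), 0 <= K ->
  (forall m, measurable_fun setT (f m)) ->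
  (forall m x, `|f m x| <= M) ->
  (forall x, limsup_norm_le (f^~ x) K) ->
  limsup_norm_le (fun m => charge_integral nu (f m)) (C * K).
Proof.
pose mp := jordan_pos (hahn_posneg nu); pose mn := jordan_neg (hahn_posneg nu).
(* This is the total mass of the variation of [nu]. *)
exists (fine (mp setT) + fine (mn setT)); first by rewrite addr_ge0// fine_ge0.
move=> f M K K0 mf fM fK; rewrite mulrC mulrDr.
apply: limsup_norm_leB.
  apply: (limsup_norm_le_Rintegral (M := M)) => //.
  exact: fin_num_fun_lty (fin_num_measure mp).
apply: (limsup_norm_le_Rintegral (M := M)) => //.
exact: fin_num_fun_lty (fin_num_measure mn).
Qed.

Lemma cintegralB mu (f g : T -> R[i]) :
  bounded_measurable f -> bounded_measurable g ->
  cintegral mu (fun x => f x - g x) = cintegral mu f - cintegral mu g.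
Proof.
move=> [mRf mIf [Mf fM]] [mRg mIg [Mg gM]].
have fRe x : `|complex.Re (f x)| <= Num.max Mf Mg.
  by rewrite (le_trans (ler_Re_rnorm _))// le_max fM.
have fIm x : `|complex.Im (f x)| <= Num.max Mf Mg.
  by rewrite (le_trans (ler_Im_rnorm _))// le_max fM.
have gRe x : `|complex.Re (g x)| <= Num.max Mf Mg.
  by rewrite (le_trans (ler_Re_rnorm _))// le_max gM orbT.
have gIm x : `|complex.Im (g x)| <= Num.max Mf Mg.
  by rewrite (le_trans (ler_Im_rnorm _))// le_max gM orbT.
have eRe : (fun x => complex.Re (f x - g x)) =
    (fun x => complex.Re (f x) - complex.Re (g x)).
  by apply/funext => x; rewrite raddfB.
have eIm : (fun x => complex.Im (f x - g x)) =
    (fun x => complex.Im (f x) - complex.Im (g x)).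
  by apply/funext => x; rewrite raddfB.
rewrite /cintegral eRe eIm.
rewrite !(charge_integralB _ (M := Num.max Mf Mg))//.
apply/eqP; rewrite eq_complex /=; apply/andP; split; apply/eqP; ring.
Qed.

Lemma limsup_cintegral mu : exists2 C : R, 0 <= C &
  forall (f : nat -> T -> R[i]) (M K : R), 0 <= K ->
  (forall m, bounded_measurable (f m)) ->
  (forall m x, rnorm (f m x) <= M) ->
  (forall x, limsup_norm_le (fun m => rnorm (f m x)) K) ->
  limsup_norm_le (fun m => rnorm (cintegral mu (f m))) (C * K).
Proof.
have [Cr Cr0 HCr] := limsup_charge_integral (cm_Re mu).
have [Ci Ci0 HCi] := limsup_charge_integral (cm_Im mu).
(* The real and the imaginary part of the integral each combine one integral against [cm_Re mu] and
   one against [cm_Im mu]. *)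
exists (Cr + Ci + (Cr + Ci)); first by rewrite !addr_ge0.
move=> f M K K0 mf fM fK.
have bRe m x : `|complex.Re (f m x)| <= M by rewrite (le_trans (ler_Re_rnorm _)).
have bIm m x : `|complex.Im (f m x)| <= M by rewrite (le_trans (ler_Im_rnorm _)).
have kRe x : limsup_norm_le (fun m => complex.Re (f m x)) K.
  apply: limsup_norm_leW (fK x) => m.
  by rewrite (le_trans (ler_Re_rnorm _))// ler_norm.
have kIm x : limsup_norm_le (fun m => complex.Im (f m x)) K.
  apply: limsup_norm_leW (fK x) => m.
  by rewrite (le_trans (ler_Im_rnorm _))// ler_norm.
have mRe m : measurable_fun setT (fun x => complex.Re (f m x)) by have [] := mf m.
have mIm m : measurable_fun setT (fun x => complex.Im (f m x)) by have [] := mf m.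
have cRR := HCr _ _ _ K0 mRe bRe kRe; have cRI := HCr _ _ _ K0 mIm bIm kIm.
have cIR := HCi _ _ _ K0 mRe bRe kRe; have cII := HCi _ _ _ K0 mIm bIm kIm.
have abs (u : nat -> R) (L : R) : limsup_norm_le u L ->
    limsup_norm_le (fun m => `|u m|) L.
  by move=> uL; apply: limsup_norm_leW uL => m; rewrite normr_id.
have := limsup_norm_leD (abs _ _ (limsup_norm_leB cRR cII))
  (abs _ _ (limsup_norm_leD cRI cIR)).
rewrite -!mulrDl; apply: limsup_norm_leW => m.
rewrite ger0_norm ?rnorm_ge0// [leRHS]ger0_norm ?addr_ge0//.
exact: ler_rnorm_ReIm.
Qed.

End cintegral_theory.

(** * Boundedness and Borel measurability of maps with property (A) *)

Section borel.
Context (R : realType) (T : ptopologicalType).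

Lemma continuous_borel_measurable (f : T -> R) : continuous f ->
  measurable_fun setT (f : borel T -> R).
Proof.
move=> /continuousP cf; apply: (measurability _ (RGenOpens.measurableE R)).
move=> _ [_ [a [b ->] <-]]; rewrite setTI; apply: sub_sigma_algebra.
exact/cf/interval_open.
Qed.

Lemma continuous_Re (f : T -> R[i]) : continuous f ->
  continuous (fun x => complex.Re (f x)).
Proof.
move=> cf x; apply/cvgrPdist_lt => e e0.
have /(@cvg_rnormP R _ _ (nbhs x)) /(_ _ e0) := cf x.
apply: filterS => y; apply: le_lt_trans.
by rewrite -raddfB ler_Re_rnorm.
Qed.

Lemma continuous_Im (f : T -> R[i]) : continuous f ->
  continuous (fun x => complex.Im (f x)).
Proof.
move=> cf x; apply/cvgrPdist_lt => e e0.
have /(@cvg_rnormP R _ _ (nbhs x)) /(_ _ e0) := cf x.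
apply: filterS => y; apply: le_lt_trans.
by rewrite -raddfB ler_Im_rnorm.
Qed.

Lemma property_A_rnorm_bounded (X : normedModType R[i]) (U : topologicalType)
    (w : U -> X) : property_A w -> exists M : R, forall t, rnorm (w t) <= M.
Proof.
move=> [w_ [_ [M wM] ww]]; exists M => t; apply/ler_addgt0Pr => e e0.
have /(@cvg_rnormP R _ _ \oo)/(_ _ e0)[m _ /(_ m (leqnn _))/= wm] := ww t.
rewrite -(subrK (w_ m t) (w t)) (le_trans (rnormD _ _))// addrC lerD//.
exact: ltW.
Qed.

(** A pointwise limit of continuous functions is Borel; this makes the components of maps in B_nA
    integrable against the Riesz measures. *)
Lemma property_A_bounded_measurable (w : T -> R[i]) : property_A w ->
  bounded_measurable (w : borel T -> R[i]).
Proof.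
move=> Aw; have wM := property_A_rnorm_bounded Aw.
have [w_ [cw _ ww]] := Aw.
split => //.
- apply: (@measurable_fun_cvg _ (borel T) R setT (fun m x => complex.Re (w_ m x))).
    by move=> m; apply: continuous_borel_measurable; exact: continuous_Re (cw m).
  move=> x _; apply/cvgrPdist_lt => e e0.
  have /(@cvg_rnormP R _ _ \oo) /(_ _ e0) := ww x.
  by apply: filterS => y; apply: le_lt_trans; rewrite -raddfB ler_Re_rnorm.
- apply: (@measurable_fun_cvg _ (borel T) R setT (fun m x => complex.Im (w_ m x))).
    by move=> m; apply: continuous_borel_measurable; exact: continuous_Im (cw m).
  move=> x _; apply/cvgrPdist_lt => e e0.
  have /(@cvg_rnormP R _ _ \oo) /(_ _ e0) := ww x.
  by apply: filterS => y; apply: le_lt_trans; rewrite -raddfB ler_Im_rnorm.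
Qed.

End borel.

(** * Stability of property (A) *)

Section property_A_theory.
Context (R : realType) (T : topologicalType).

Lemma property_A_lc (X Y : normedModType R[i]) (f : lc X Y) (w : T -> X) :
  property_A w -> property_A (fun t => f (w t)).
Proof.
move=> [w_ [cw [M wM] ww]]; exists (fun m t => f (w_ m t)); split.
- by move=> m x; apply: continuous_comp; [exact: cw|exact: lc_continuous].
- exists (opnorm f * M) => m t.
  by rewrite (le_trans (opnorm_ub f _))// ler_wpM2l// opnorm_ge0.
- by move=> t; apply: continuous_cvg (ww t); exact: lc_continuous.
Qed.

Lemma property_AB (X : normedModType R[i]) (v w : T -> X) :
  property_A v -> property_A w -> property_A (fun t => v t - w t).
Proof.
move=> [v_ [cv [Mv vM] vv]] [w_ [cw [Mw wM] ww]].
exists (fun m t => v_ m t - w_ m t); split.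
- by move=> m x; apply: cvgB; [exact: cv|exact: cw].
- exists (Mv + Mw) => m t; rewrite (le_trans (rnormD _ _))// rnormN lerD//.
- by move=> t; apply: cvgB.
Qed.

Lemma real_complex_continuous : continuous (fun a : R => a%:C%C : R[i]).
Proof.
move=> x; apply/(@cvg_rnormP R _ _ (nbhs x)) => e e0.
near=> y; rewrite -rmorphB /=.
have -> : rnorm ((x - y)%:C%C : R[i]) = `|x - y|.
  by rewrite rnorm_complex /= expr0n addr0 sqrtr_sqr.
by near: y; exact: cvgr_dist_lt.
Unshelve. all: by end_near. Qed.

Lemma rnorm_real (a : R) : rnorm (a%:C%C : R[i]) = `|a|.
Proof. by rewrite rnorm_complex /= expr0n addr0 sqrtr_sqr. Qed.

Lemma continuous_realZ (X : normedModType R[i]) (eta : T -> R) (w : T -> X) :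
  continuous eta -> continuous w -> continuous (fun t => (eta t)%:C%C *: w t).
Proof.
move=> ceta cw x; apply: cvgZ; last exact: cw.
exact: (continuous_comp (ceta x) (@real_complex_continuous _)).
Qed.

Lemma property_AZ (X : normedModType R[i]) (eta : T -> R) (w : T -> X) :
  continuous eta -> (forall t, `|eta t| <= 1) -> property_A w ->
  property_A (fun t => (eta t)%:C%C *: w t).
Proof.
move=> ceta eta1 [w_ [cw [M wM] ww]].
exists (fun m t => (eta t)%:C%C *: w_ m t); split.
- by move=> m; exact: continuous_realZ.
- exists M => m t; rewrite rnormZ rnorm_real -[leRHS]mul1r ler_pM ?rnorm_ge0//.
- by move=> t; apply: cvgZ; [exact: cvg_cst|exact: ww].
Qed.

Lemma property_A_bounded_continuous (X : normedModType R[i]) (w : T -> X) (M : R) :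
  continuous w -> (forall t, rnorm (w t) <= M) -> property_A w.
Proof.
by move=> cw wM; exists (fun=> w); split=> // [|t]; [exists M|exact: cvg_cst].
Qed.

End property_A_theory.

(** * Coordinate functionals on C^n *)

Section coordinates.
Context (R : realType) (n : nat) (N : vnorm R n).

Lemma Cn_coord_subproof (k : 'I_n) :
  (fun x : Cn N => (x : 'cV[R[i]]_n) k 0 : R[i]) \in lc_pred (Cn N) R[i].
Proof.
have [C _ HC] := rnorm_coord N.
by apply: (@lc_intro _ _ _ _ C) => // a x y; rewrite !mxE.
Qed.

(** The functionals at which equations in the bidual are tested; they turn the extended equation
    into [n] scalar ones. *)
Definition Cn_coord (k : 'I_n) : dual (Cn N) := Lc (Cn_coord_subproof k).

Lemma rnorm_le_coord (x : Cn N) :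
  rnorm x <= \sum_k rnorm (e_ N k) * rnorm (Cn_coord k x).
Proof.
rewrite [x in leLHS]Cn_sum_e (le_trans (ler_rnorm_sum _ _ _))//.
by apply: ler_sum => k _; rewrite rnormZ mulrC.
Qed.

End coordinates.

(** * The extension of an operator to maps with property (A) *)

Section extension.
Context (R : realType) (n : nat) (h : {posnum R}) (N : vnorm R n).
Local Notation Ccn := (cts h (Cn N)).

Lemma property_A_cts (f : Ccn) : property_A f.
Proof.
apply: (property_A_bounded_continuous (M := cts_rnorm f)); first exact: cts_continuous.
exact: cts_rnorm_ub.
Qed.

Lemma property_A_component (k : 'I_n) (phi : segI h -> Cn N) :
  property_A phi -> property_A (component k phi).
Proof. exact: (property_A_lc (Cn_coord N k)). Qed.

Lemma property_A_BnA (phi : segI h -> Cn N) : property_A phi -> in_BnA phi.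
Proof. by move=> Aphi k; exact: property_A_component. Qed.

Context (Y : normedModType R[i]) (Lam : lc Ccn Y)
  (LamE : (segI h -> Cn N) -> dual (dual Y)).
Hypothesis ext : is_extension Lam LamE.
Variable ys : dual Y.

(** A continuous [f] is the sum of its components embedded by the [E_ N k], and on each of these the
    Riesz measures represent [ys \o Lam]. *)
Lemma extension_cts (f : Ccn) : LamE f ys = ys (Lam f).
Proof.
have [mu rmu ->] := ext ys; last exact/property_A_BnA/property_A_cts.
have cf k : component k f \in cts_pred h R[i].
  apply/asboolP => s; apply: (@continuous_comp _ _ _ (cts_val f) (Cn_coord N k)).
    exact: cts_continuous.
  exact: lc_continuous.
have fE : f = \sum_k E_ N k (Cts (cf k)).
  apply/val_inj/funext => s /=.
  have -> : cts_val (\sum_k E_ N k (Cts (cf k))) s =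
      \sum_k cts_val (E_ N k (Cts (cf k))) s.
    by elim/big_ind2: _ => // _ a _ b <- <-.
  by rewrite [LHS]Cn_sum_e.
rewrite [in RHS]fE !linear_sum; apply: eq_bigr => k _.
by have [_ /(_ (Cts (cf k)))/= ->] := rmu k.
Qed.

Lemma extensionB (phi psi : segI h -> Cn N) :
  property_A phi -> property_A psi ->
  LamE (fun s => phi s - psi s) ys = LamE phi ys - LamE psi ys.
Proof.
move=> Aphi Apsi; have [mu _ muE] := ext ys.
rewrite !muE; [|exact: property_A_BnA..|exact/property_A_BnA/property_AB].
rewrite -sumrB; apply: eq_bigr => k _.
rewrite -cintegralB; [|exact/property_A_bounded_measurable/property_A_component..].
by congr (cintegral _ _); apply/funext => s; rewrite /component !mxE.
Qed.

(** The limit theorem behind all later estimates: [limsup_cintegral] is applied to each component.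
    With [K = 0] it says that bounded pointwise convergence to 0 is preserved. *)
Lemma limsup_extension : exists2 C : R, 0 <= C &
  forall (phi : nat -> segI h -> Cn N) (M K : R), 0 <= K ->
  (forall m, property_A (phi m)) ->
  (forall m s, rnorm (phi m s) <= M) ->
  (forall s, limsup_norm_le (fun m => rnorm (phi m s)) K) ->
  limsup_norm_le (fun m => rnorm (LamE (phi m) ys)) (C * K).
Proof.
have [mu _ muE] := ext ys; have [D D0 HD] := rnorm_coord N.
pose C k := s2val (cid2 (limsup_cintegral (mu k))).
have C0 k : 0 <= C k := s2valP (cid2 (limsup_cintegral (mu k))).
(* [C k] comes from the [k]-th Riesz measure, [D] from the bound on the coordinates. *)
exists (\sum_k C k * D) => [|phi M K K0 Aphi phiM phiK].
  by apply: sumr_ge0 => k _; rewrite mulr_ge0.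
have cK k : limsup_norm_le
    (fun m => rnorm (cintegral (mu k) (component k (phi m)))) (C k * (D * K)).
  apply: (s2valP' (cid2 (limsup_cintegral (mu k))) _ (D * M)).
  - exact: mulr_ge0.
  - by move=> m; exact/property_A_bounded_measurable/property_A_component.
  - by move=> m s; rewrite (le_trans (HD _ _))// ler_wpM2l.
  - move=> s; apply: limsup_norm_leW (limsup_norm_leZ D0 (phiK s)) => m.
    rewrite !ger0_norm ?mulr_ge0 ?rnorm_ge0//; exact: HD.
rewrite mulr_suml; under eq_bigr do rewrite -mulrA.
apply: limsup_norm_leW (limsup_norm_le_sum cK) => m.
rewrite !ger0_norm ?rnorm_ge0//; last by apply: sumr_ge0 => k _; exact: rnorm_ge0.
by rewrite muE; [exact: ler_rnorm_sum|exact: property_A_BnA].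
Qed.

(** [limsup_extension] for constant sequences, where a uniform bound is also a bound on the
    limsup. *)
Lemma extension_bounded : exists C : R,
  forall (phi : segI h -> Cn N) (M : R), property_A phi ->
  (forall s, rnorm (phi s) <= M) -> rnorm (LamE phi ys) <= C * M.
Proof.
have [C C0 HC] := limsup_extension; exists C => phi M Aphi phiM.
have M0 : 0 <= M := le_trans (rnorm_ge0 _) (phiM (I0 h)).
apply: limsup_norm_le_cst (HC (fun=> phi) M M M0 _ _ _) _ => // [s e e0|_].
  near=> m; rewrite ger0_norm ?rnorm_ge0// (le_trans (phiM s))// lerDl.
  exact: ltW.
exact: ler_norm.
Unshelve. all: by end_near. Qed.

End extension.

(** * The delay in the operator [L] *)

Section delay.
Context (R : realType) (n : nat) (h : {posnum R}) (N : vnorm R n).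
Local Notation Ccn := (cts h (Cn N)).
Context (L : lc Ccn (Cn N)) (LE : (segI h -> Cn N) -> dual (dual (Cn N))).
Hypothesis hDelta : condition_Delta L.
Hypothesis ext : is_extension L LE.

Lemma I_val_continuous : continuous (@I_val R h).
Proof. exact: initial_continuous. Qed.

(* A cutoff that vanishes on [-h, -Delta] and is 1 on [-Delta/2, 0] splits
   off a part that LE annihilates, since L kills its continuous approximants. *)
Lemma limsup_extension_delay : exists2 d : R, 0 < d &
  forall (ys : dual (Cn N)) (phi : nat -> segI h -> Cn N) (M : R),
  (forall m, property_A (phi m)) ->
  (forall m s, rnorm (phi m s) <= M) ->
  (forall s, I_val s <= - d -> limsup_norm_le (fun m => rnorm (phi m s)) 0) ->
  limsup_norm_le (fun m => rnorm (LE (phi m) ys)) 0.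
Proof.
have [D /andP[D0 Dh] LD] := hDelta; exists (D / 2); first by rewrite divr_gt0.
move=> ys phi M Aphi phiM phi0.
(* Affine with slope [2 / D] between [- D] and [- (D / 2)], truncated to values in [0, 1]. *)
pose eta (s : segI h) : R := Num.max 0 (Num.min 1 ((I_val s + D) * (2 / D))).
have eta0 s : I_val s <= - D -> eta s = 0.
  move=> sD; rewrite /eta; apply/max_idPl; rewrite ge_min; apply/orP; right.
  rewrite mulr_le0_ge0 ?divr_ge0 ?(ltW D0)//; lra.
have eta1 s : - (D / 2) <= I_val s -> eta s = 1.
  move=> sD; rewrite /eta min_l ?max_r//.
  rewrite -ler_pdivrMr ?divr_gt0// invf_div mul1r; lra.
have eta_ge0 s : 0 <= eta s by rewrite le_max lexx.
have eta_le1 s : eta s <= 1 by rewrite ge_max ler01 ge_min lexx.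
have ceta : continuous eta.
  move=> s; suff : {for s, continuous ((cst 0 : segI h -> R^o) \max
      ((cst 1 : segI h -> R^o) \min (fun s => (I_val s + D) * (2 / D) : R^o)))}.
    by [].
  apply: continuous_max; first exact: cst_continuous.
  apply: continuous_min; first exact: cst_continuous.
  apply: continuousM; last exact: cst_continuous.
  by apply: continuousD; [exact: I_val_continuous|exact: cst_continuous].
have etaA w : property_A w ->
    property_A (fun s => (eta s)%:C%C *: w s : Cn N).
  by apply: property_AZ => // s; rewrite ger0_norm.
(* For the continuous approximants [w_ i] the product with [eta] is continuous and vanishes on
   [-h, -D], so [L] kills it. The differences [f i - eta w] are bounded and tend to 0 pointwise,
   while [LE] has the same norm on all of them. *)
have LE0 w : property_A w -> LE (fun s => (eta s)%:C%C *: w s) ys = 0.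
  move=> Aw; have [C C0 HC] := limsup_extension ext ys.
  have [w_ [cw [B wB] ww]] := Aw; have [B' wB'] := property_A_rnorm_bounded Aw.
  have Aw_ i : property_A (w_ i) by apply: property_A_bounded_continuous (cw i) (wB i).
  pose f i : segI h -> Cn N := fun s => (eta s)%:C%C *: w_ i s.
  have cf i : f i \in cts_pred h (Cn N).
    by apply/asboolP; exact: continuous_realZ.
  have LEf i : LE (f i) ys = 0.
    rewrite (extension_cts ext ys (Cts (cf i))) LD ?linear0// => s /andP[_ sD].
    by rewrite /= /f eta0// scale0r.
  apply: rnorm_eq0; apply/eqP; rewrite eq_le rnorm_ge0 andbT.
  have := HC (fun i s => f i s - (eta s)%:C%C *: w s) (B + B') 0 (lexx _).
  rewrite mulr0 => H; apply: limsup_norm_le_cst (H _ _ _) _.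
  - by move=> i; apply: property_AB; exact: etaA.
  - move=> i s; rewrite -scalerBr rnormZ rnorm_real ger0_norm// -[leRHS]mul1r.
    rewrite ler_pM ?rnorm_ge0// (le_trans (rnormD _ _))// rnormN lerD//.
  - move=> s e e0; have /(@cvg_rnormP R _ _ \oo)/(_ _ e0) := ww s.
    apply: filterS => i wi; rewrite -scalerBr rnormZ rnorm_real normrM normr_id.
    rewrite (ger0_norm (eta_ge0 s)) (ger0_norm (rnorm_ge0 _)) add0r -[leRHS]mul1r.
    by rewrite ler_pM ?rnorm_ge0// -rnormN opprB ltW.
  - move=> i; rewrite (extensionB ext); [|exact: etaA..].
    by rewrite LEf sub0r rnormN ler_norm.
(* By [LE0] only [(1 - eta) phi m] contributes. Up to [- (D / 2)] it tends to 0 by [phi0], and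
   beyond that point it is 0. *)
have [C C0 HC] := limsup_extension ext ys.
have := HC (fun m s => phi m s - (eta s)%:C%C *: phi m s) M 0 (lexx _).
have dE m s : phi m s - (eta s)%:C%C *: phi m s = (1 - eta s)%:C%C *: phi m s.
  by rewrite rmorphB scalerBl scale1r.
have dN m s : rnorm ((1 - eta s)%:C%C *: phi m s) <= rnorm (phi m s).
  rewrite rnormZ rnorm_real -[leRHS]mul1r ler_wpM2r ?rnorm_ge0//.
  by rewrite ger0_norm ?subr_ge0// gerBl.
rewrite mulr0 => H; apply: limsup_norm_leW (H _ _ _) => [m||m s|s].
- by rewrite (extensionB ext)// ?LE0 ?subr0//; exact: etaA.
- by move=> m; apply: property_AB => //; exact: etaA.
- by rewrite dE (le_trans (dN _ _)).
- have [sD|sD] := leP (I_val s) (- (D / 2)).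
    apply: limsup_norm_leW (phi0 _ sD) => m.
    by rewrite !ger0_norm ?rnorm_ge0// dE.
  move=> e e0; near=> m.
  rewrite eta1; last exact: ltW.
  by rewrite scale1r subrr rnorm0 normr0 add0r ltW.
Unshelve. all: by end_near. Qed.

End delay.

(** * Segments of continuous maps and their dependence on time *)

Section segments.
Context (R : realType) (n : nat) (h : {posnum R}) (N : vnorm R n).
Local Notation Ccn := (cts h (Cn N)).

Lemma I_val_itv (s : segI h) : - h%:num <= I_val s <= 0.
Proof. by have := valP s; rewrite inE /= in_itv. Qed.

(** [Num.max a] is a continuous retraction of the line onto [[a, +oo[], so [v] is extended by its
    value at [a]. *)
Lemma within_itvcy_continuous (a : R) (v : R -> Cn N) :
  {within `[a, +oo[, continuous v} -> continuous (fun t => v (Num.max a t)).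
Proof.
move=> cv x P vP.
have aA t : `[a, +oo[%classic (Num.max a t) by rewrite /= in_itv/= andbT le_max lexx.
have H : within `[a, +oo[ (nbhs (Num.max a x)) (v @^-1` P).
  by rewrite (nbhs_subspace_in (aA x)); exact: cv.
have cmax : {for x, continuous (fun t : R => Num.max a t : R^o)}.
  apply: (@continuous_max _ _ (cst a) id); first exact: cst_continuous.
  exact: cvg_id.
have K : \forall t \near x, `[a, +oo[%classic (Num.max a t) ->
  P (v (Num.max a t)) := cmax _ H.
by apply: (@filterS _ (nbhs x) _ _ _ _ K) => t; apply; exact: aA.
Qed.

Lemma segment_continuous (v : R -> Cn N) (t : R) :
  continuous v -> segment v t \in cts_pred h (Cn N).
Proof.
move=> cv; apply/asboolP.
have cs : continuous (fun s : segI h => t + I_val s).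
  by move=> s; apply: continuousD; [exact: cst_continuous|exact: I_val_continuous].
by move=> s; apply: (@continuous_comp _ _ _ (fun s : segI h => t + I_val s) v);
  [exact: cs|exact: cv].
Qed.

Lemma csegmentE (v : R -> Cn N) (t : R) :
  continuous v -> csegment h v t = segment v t :> (segI h -> Cn N).
Proof. by move=> cv; rewrite /csegment insubdK//; exact: segment_continuous. Qed.

Lemma segment_property_A (v : R -> Cn N) (t : R) :
  continuous v -> property_A (segment v t : segI h -> Cn N).
Proof. by move=> cv; rewrite -csegmentE//; exact: property_A_cts. Qed.

Lemma continuous_rnorm_bounded (v : R -> Cn N) (a b : R) : continuous v ->
  exists M : R, forall t, a <= t <= b -> rnorm (v t) <= M.
Proof.
move=> cv.
have cg : continuous (fun t => rnorm (v t)).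
  move=> t; apply: (@continuous_comp _ _ _ v (@rnorm R _)); first exact: cv.
  exact: rnorm_continuous.
have /compact_bounded[M [_ gM]] :=
  continuous_compact (continuous_subspaceT cg) (@segment_compact _ a b).
exists (M + 1) => t tab; apply: le_trans (ler_norm _) _.
by apply: gM; rewrite ?ltrDl//; exists t => //=; rewrite in_itv.
Qed.

Context (Y : normedModType R[i]) (Lam : lc Ccn Y)
  (LamE : (segI h -> Cn N) -> dual (dual Y)).
Hypothesis ext : is_extension Lam LamE.
Variable ys : dual Y.

Lemma extension_segment (v : R -> Cn N) (t : R) : continuous v ->
  LamE (segment v t) ys = ys (Lam (csegment h v t)).
Proof. by move=> cv; rewrite -csegmentE// (extension_cts ext). Qed.

(** The segments at the times [u m] are bounded and converge pointwise to the segment at [t], so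
    [limsup_extension] applies with bound 0. *)
Lemma cvg_csegment (v : R -> Cn N) (u : nat -> R) (t : R) : continuous v ->
  u @ \oo --> t ->
  limsup_norm_le (fun m => rnorm (ys (Lam (csegment h v (u m))) -
    ys (Lam (csegment h v t)))) 0.
Proof.
move=> cv ut; have [C C0 HC] := limsup_extension ext ys.
have [B uB] : exists B, forall m, `|u m| <= B.
  have [B [_ /(_ (B + 1))]] := cvg_seq_bounded (cvgP _ ut).
  by rewrite ltrDl ltr01 => /(_ isT) uB; exists (B + 1) => m; exact: uB.
(* All arguments [u m + I_val s] lie in this interval, because |u m| <= B. *)
have [M vM] := continuous_rnorm_bounded (- B - h%:num) B cv.
have [M' vM'] := continuous_rnorm_bounded (t - h%:num) t cv.
have := HC (fun m s => segment v (u m) s - segment v t s) (M + M') 0 (lexx _).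
rewrite mulr0 => H; apply: limsup_norm_leW (H _ _ _) => [m||m s|s].
- rewrite (extensionB ext); [|exact: segment_property_A..].
  by rewrite !extension_segment.
- by move=> m; apply: property_AB; exact: segment_property_A.
- have /andP[hs s0] := I_val_itv s; have := uB m; rewrite ler_norml => /andP[Bu uB'].
  rewrite (le_trans (rnormD _ _))// rnormN lerD//.
    by apply: vM; rewrite lerD//= -[leRHS]addr0 lerD.
  by apply: vM'; rewrite lerD2l hs /= -[leRHS]addr0 lerD2l.
- move=> e e0; rewrite add0r.
  have /(@cvg_rnormP R _ _ \oo)/(_ _ e0) :
      v (u m + I_val s) @[m --> \oo] --> v (t + I_val s).
    apply: continuous_cvg; first exact: cv.
    by apply: cvgD => //; exact: cvg_cst.
  apply: filterS => m vm.
  by rewrite ger0_norm ?rnorm_ge0// -rnormN opprB ltW.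
Qed.

End segments.

(** * The integrated form of the neutral equation *)

Section neutral_integral.
Context (R : realType) (n : nat) (h : {posnum R}) (N : vnorm R n).
Local Notation Ccn := (cts h (Cn N)).
Context (L Rop : lc Ccn (Cn N)).

(* The values of a solution to the left of -h are junk, so it may be assumed
   continuous on the whole line. *)
Lemma neutral_solution_continuous (phi : Ccn) (v : R -> Cn N) :
  neutral_solution L Rop phi v ->
  exists v', [/\ continuous v', neutral_solution L Rop phi v' &
    forall t, 0 <= t -> csegment h v' t = csegment h v t].
Proof.
move=> [cv v0 dv]; exists (fun t => v (Num.max (- h%:num) t)).
have vE t : - h%:num <= t -> v (Num.max (- h%:num) t) = v t.
  by move=> ht; rewrite max_r.
have cv' := within_itvcy_continuous cv.
have sE t : 0 <= t ->
    csegment h (fun t => v (Num.max (- h%:num) t)) t = csegment h v t.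
  move=> t0; rewrite /csegment; congr (insubd _ _); apply/funext => s.
  rewrite /segment vE//; have /andP[hs _] := I_val_itv s.
  by rewrite (le_trans hs)// lerDr.
split => //; split; first exact: continuous_subspaceT.
  by rewrite sE.
move=> t t0; rewrite /has_derivative_within sE//.
have := dv _ t0; rewrite /has_derivative_within.
have ht s : 0 <= s -> - h%:num <= s by apply: le_trans; rewrite oppr_le0.
move=> /(@cvg_rnormP R _ _ (within `[0, +oo[ t^')) H.
apply/(@cvg_rnormP R _ _ (within `[0, +oo[ t^')) => e e0; have := H e e0.
apply: filterS2; last exact: withinT.
move=> s /=; rewrite in_itv/= andbT => s0; rewrite !vE ?sE//; exact: ht.
Qed.

Context (LE RE : (segI h -> Cn N) -> dual (dual (Cn N))).
Hypothesis extL : is_extension L LE.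
Hypothesis extR : is_extension Rop RE.
Variable (ys : dual (Cn N)) (phi : Ccn) (v : R -> Cn N).
Hypothesis cv : continuous v.
Hypothesis sol : neutral_solution L Rop phi v.

(* rho is the real or the imaginary part. *)
Let real_functional (rho : R[i] -> R) : Prop :=
  [/\ forall x y, rho (x - y) = rho x - rho y,
      forall (a : R) x, rho (a%:C%C * x) = a * rho x &
      forall x, `|rho x| <= rnorm x].

(** Continuity in [s] is reduced to sequences, for which [cvg_csegment] holds. *)
Let real_functional_continuous (Lam : lc Ccn (Cn N)) LamE rho :
  is_extension Lam LamE -> real_functional rho ->
  continuous (fun s : R => rho (ys (Lam (csegment h v s)))).
Proof.
move=> ext [rhoB _ rho_le] t; apply/continuous_withinNx/cvgr_dnbhsP => u [_ ut].
have /limsup_norm_le0P H := cvg_csegment ext ys cv ut.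
apply/cvgrPdist_lt => e e0; have /cvgr0Pnorm_lt/(_ _ e0) := H.
apply: filterS => m; rewrite ger0_norm ?rnorm_ge0//; apply: le_lt_trans.
by rewrite -rhoB -rnormN opprB.
Qed.

(** The fundamental theorem of calculus: [G] is continuous and has the continuous derivative [f] at
    all positive times. *)
Let real_functional_FTC rho (T : R) : real_functional rho -> 0 < T ->
  lebesgue_measure.-integrable `]0, T[
    (EFin \o (fun s => rho (ys (Rop (csegment h v s))))) /\
  \int[lebesgue_measure]_(s in `]0, T[) rho (ys (Rop (csegment h v s))) =
  rho (ys (v T - L (csegment h v T))) - rho (ys (v 0 - L (csegment h v 0))).
Proof.
move=> rrho T0; have [rhoB rhoZ rho_le] := rrho.
pose f s := rho (ys (Rop (csegment h v s))).
pose G s := rho (ys (v s - L (csegment h v s))).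
have cf : continuous f by exact: real_functional_continuous extR rrho.
have cG : continuous G.
  have -> : G = (fun s => rho (ys (v s)) - rho (ys (L (csegment h v s)))).
    by apply/funext => s; rewrite /G linearB rhoB.
  move=> s; apply: cvgB; last exact: real_functional_continuous extL rrho s.
  apply/cvgrPdist_lt => e e0.
  have /(@cvg_rnormP R _ _ (nbhs s))/(_ _ e0) :
      ys (v t) @[t --> s] --> ys (v s).
    by apply: (@continuous_comp _ _ _ v ys); [exact: cv|exact: lc_continuous].
  by apply: filterS => t; apply: le_lt_trans; rewrite -rhoB.
have dG (t : R) : 0 < t -> is_derive t (1 : R) G (f t).
  move=> t0; suff dG : r^-1 *: (G (r *: (1 : R) + t) - G t) @[r --> 0^'] --> f t.
    by apply: DeriveDef; [apply/cvg_ex; exists (f t)|exact/cvg_lim].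
  have [_ _ /(_ _ (ltW t0))] := sol.
  rewrite /has_derivative_within => H.
  have {}H : ys ((s - t)^-1%:C%C *: ((v s - L (csegment h v s)) -
      (v t - L (csegment h v t)))) @[s --> within `[0, +oo[ t^']
      --> ys (Rop (csegment h v t)).
    by apply: continuous_cvg H; exact: lc_continuous.
  apply/cvgrPdist_lt => e e0.
  have /(@cvg_rnormP R _ _ (within `[0, +oo[ t^'))/(_ _ e0) := H.
  rewrite /within/= => -[d /= d0 Hd].
  (* The radius is at most [t], so that [r + t] stays in the half-line on which the difference
     quotient is controlled. *)
  exists (Num.min d t) => /=; first by rewrite lt_min d0.
  move=> r /=; rewrite sub0r normrN lt_min => /andP[rd rt] r0.
  have tr : 0 < r + t.
    by move: rt; rewrite ltr_norml => /andP[]; rewrite -subr_gt0 opprK.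
  have := Hd (r + t); rewrite /= opprD addrCA subrr addr0 normrN => /(_ rd).
  have -> : r + t - t = r by ring.
  rewrite in_itv/= andbT (ltW tr) -subr_eq0.
  have -> : r + t - t = r by ring.
  move=> /(_ r0 isT); apply: le_lt_trans; rewrite [r *: 1]mulr1.
  have ysE (a : R[i]) x y : ys (a *: (x - y)) = a * (ys x - ys y).
    by rewrite linearZ linearB.
  rewrite ysE.
  rewrite -[_ *: (G _ - G _)]/(r^-1 * (G _ - G _)) /G -rhoB -rhoZ -rhoB.
  exact: rho_le.
have FTC : (\int[lebesgue_measure]_(x in `[0%R, T]) (f x)%:E)%E =
    ((G T)%:E - (G 0)%:E)%E.
  apply: continuous_FTC2 => //; first exact: continuous_subspaceT.
    split.
    - by move=> t; rewrite in_itv/= => /andP[t0 _]; have [] := dG t t0.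
    - by apply: cvg_at_right_filter; exact: cG.
    - by apply: cvg_at_left_filter; exact: cG.
  move=> t; rewrite in_itv/= => /andP[t0 _]; rewrite derive1E.
  exact: (@derive_val _ _ _ _ _ _ _ (dG t t0)).
have fi : lebesgue_measure.-integrable `[0, T] (EFin \o f).
  apply: continuous_compact_integrable; first exact: segment_compact.
  exact: continuous_subspaceT.
have fio : lebesgue_measure.-integrable `]0, T] (EFin \o f).
  by apply: integrableS fi => //; exact: subset_itv_oc_cc.
have fioo : lebesgue_measure.-integrable `]0, T[ (EFin \o f).
  by apply: integrableS fi => //; exact: subset_itv_oo_cc.
split => //; rewrite Rintegral_itv_bndo_bndc// Rintegral_itv_obnd_cbnd//.
by rewrite /Rintegral FTC.
Qed.

(** Brings a classical solution into the form of the extended equation tested at [ys], so that the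
    two equations can be subtracted. *)
Lemma neutral_solution_integral (T : R) : 0 < T ->
  clebesgue_integrable `]0, T[ (fun s => ys (Rop (csegment h v s))) /\
  ys (v T) - ys (L (csegment h v T)) = ys (v 0) - ys (L phi) +
    clebesgue_integral `]0, T[ (fun s => ys (Rop (csegment h v s))).
Proof.
move=> T0.
have rRe : real_functional (@complex.Re R).
  split=> [x y|a [x y]|x]; [by rewrite raddfB|by rewrite /= mul0r subr0|].
  exact: ler_Re_rnorm.
have rIm : real_functional (@complex.Im R).
  split=> [x y|a [x y]|x]; [by rewrite raddfB|by rewrite /= mul0r addr0|].
  exact: ler_Im_rnorm.
have [iRe eRe] := real_functional_FTC rRe T0.
have [iIm eIm] := real_functional_FTC rIm T0.
split => //; rewrite /clebesgue_integral eRe eIm.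
have [_ <- _] := sol; rewrite -!linearB.
apply/eqP; rewrite eq_complex /= !raddfD /=.
by apply/andP; split; apply/eqP; ring.
Qed.

End neutral_integral.

(** * Propagation of pointwise convergence to 0 *)

Section convergence.
Context (R : realType) (n : nat) (h : {posnum R}) (N : vnorm R n).
Local Notation Ccn := (cts h (Cn N)).
Context (L Rop : lc Ccn (Cn N)).
Context (LE RE : (segI h -> Cn N) -> dual (dual (Cn N))).
Hypothesis hDelta : condition_Delta L.
Hypothesis extL : is_extension L LE.
Hypothesis extR : is_extension Rop RE.

(** The integral is split at [T]: the first piece tends to 0 and the second is at most [K] times its
    length. The bound appears twice, for the real and for the imaginary part. *)
Lemma limsup_clebesgue_integral (f : nat -> R -> R[i]) (T t M K : R) :
  0 <= T < t -> 0 <= K ->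
  (forall m, clebesgue_integrable `]0, t[ (f m)) ->
  (forall m s, 0 < s < t -> rnorm (f m s) <= M) ->
  (forall s, 0 < s <= T -> limsup_norm_le (fun m => rnorm (f m s)) 0) ->
  (forall s, 0 < s < t -> limsup_norm_le (fun m => rnorm (f m s)) K) ->
  limsup_norm_le (fun m => rnorm (clebesgue_integral `]0, t[ (f m)))
    (K * (t - T) + K * (t - T)).
Proof.
move=> /andP[T0 Tt] K0 fi fM f0 fK.
have part (rho : R[i] -> R) : (forall z, `|rho z| <= rnorm z) ->
    (forall m, lebesgue_measure.-integrable `]0, t[ (EFin \o (fun s => rho (f m s)))) ->
    limsup_norm_le (fun m => \int[lebesgue_measure]_(s in `]0, t[) rho (f m s))
      (K * (t - T)).
  move=> rho_le fri.
  have oc m : lebesgue_measure.-integrable `]0, T] (EFin \o (fun s => rho (f m s))).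
    apply: integrableS (fri m) => // s /=; rewrite !in_itv/= => /andP[-> sT].
    exact: le_lt_trans sT Tt.
  have oo m : lebesgue_measure.-integrable `]T, t[ (EFin \o (fun s => rho (f m s))).
    apply: integrableS (fri m) => // s /=; rewrite !in_itv/= => /andP[Ts ->].
    by rewrite (le_lt_trans T0 Ts).
  have lr s k : limsup_norm_le (fun m => rnorm (f m s)) k ->
      limsup_norm_le (fun m => rho (f m s)) k.
    apply: limsup_norm_leW => m; rewrite (le_trans (rho_le _))//.
    exact: ler_norm.
  have E m : \int[lebesgue_measure]_(s in `]0, t[) rho (f m s) =
      \int[lebesgue_measure]_(s in `]0, T]) rho (f m s) +
      \int[lebesgue_measure]_(s in `]T, t[) rho (f m s).
    apply/eqP; rewrite addrC -subr_eq; apply/eqP.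
    by apply: Rintegral_itvB (fri m) _ _; rewrite bnd_simp.
  rewrite (funext E) -[K * _]add0r; apply: limsup_norm_leD.
    rewrite -[X in limsup_norm_le _ X](mul0r (fine (lebesgue_measure `]0, T]))).
    apply: (limsup_norm_le_Rintegral (M := M)) => //=.
    - by rewrite lebesgue_measure_itv/=; case: ifP => _; rewrite -?EFinB ltry.
    - by move=> m; have /integrableP[/measurable_EFinP] := oc m.
    - move=> m s; rewrite in_itv/= => /andP[s0 sT].
      by rewrite (le_trans (rho_le _))// fM// s0 (le_lt_trans sT).
    - by move=> s; rewrite in_itv/= => sT; exact/lr/f0.
  have -> : t - T = fine (lebesgue_measure `]T, t[).
    by rewrite lebesgue_measure_itv/= lte_fin Tt -EFinB.
  apply: (limsup_norm_le_Rintegral (M := M)) => //=.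
  - by rewrite lebesgue_measure_itv/=; case: ifP => _; rewrite -?EFinB ltry.
  - by move=> m; have /integrableP[/measurable_EFinP] := oo m.
  - move=> m s; rewrite in_itv/= => /andP[s0 sT].
    by rewrite (le_trans (rho_le _))// fM// sT (le_lt_trans T0).
  - move=> s; rewrite in_itv/= => /andP[s0 sT]; apply/lr/fK.
    by rewrite sT (le_lt_trans T0).
have abs (u : nat -> R) (B : R) : limsup_norm_le u B ->
    limsup_norm_le (fun m => `|u m|) B.
  by apply: limsup_norm_leW => m; rewrite normr_id.
have pRe := part _ (@ler_Re_rnorm R) (fun m => (fi m).1).
have pIm := part _ (@ler_Im_rnorm R) (fun m => (fi m).2).
apply: limsup_norm_leW (limsup_norm_leD (abs _ _ pRe) (abs _ _ pIm)) => m.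
rewrite ger0_norm ?rnorm_ge0// [leRHS]ger0_norm ?addr_ge0//.
exact: ler_rnorm_ReIm.
Qed.

Variable w : nat -> R -> Cn N.
Hypothesis w_bounded : forall T : R, exists M : R,
  forall m t, - h%:num <= t <= T -> rnorm (w m t) <= M.
Hypothesis w_A : forall m t, 0 <= t -> property_A (segment (w m) t : segI h -> Cn N).
Hypothesis w_eq : forall m k (t : R), 0 < t ->
  clebesgue_integrable `]0, t[ (fun s => RE (segment (w m) s) (Cn_coord N k)) /\
  Cn_coord N k (w m t) - LE (segment (w m) t) (Cn_coord N k) =
    Cn_coord N k (w m 0) - LE (segment (w m) 0) (Cn_coord N k) +
    clebesgue_integral `]0, t[ (fun s => RE (segment (w m) s) (Cn_coord N k)).

Let w_to0 (T : R) : Prop := forall t, - h%:num <= t <= T ->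
  limsup_norm_le (fun m => rnorm (w m t)) 0.

(* On a short interval [T, T + d] past a time up to which w tends to 0, the
   delay makes the L-term tend to 0 and the integral term is a contraction, so
   every bound on limsup |w m| can be halved. *)
Let w_to0_step : exists2 d : R, 0 < d &
  forall T, 0 <= T -> w_to0 T -> w_to0 (T + d).
Proof.
have [d1 d10 Hd1] := limsup_extension_delay hDelta extL.
pose C k := s2val (cid2 (limsup_extension extR (Cn_coord N k))).
have C0 k : 0 <= C k := s2valP (cid2 (limsup_extension extR (Cn_coord N k))).
have HC k := s2valP' (cid2 (limsup_extension extR (Cn_coord N k))).
(* The integral terms of all coordinates together will contribute at most [A * (t - T) * K]. *)
pose A : R := \sum_k rnorm (e_ N k) * (C k + C k).
have A0 : 0 <= A.
  by apply: sumr_ge0 => k _; rewrite mulr_ge0 ?rnorm_ge0// addr_ge0.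
(* The bound [d1] keeps the delayed arguments at or before [T]; the other bound gives
   [A * d <= 1 / 2], with [A + 1] in place of [A] to stay positive. *)
pose d := Num.min d1 (2 * (A + 1))^-1.
have d0 : 0 < d by rewrite lt_min d10 invr_gt0 mulr_gt0// ltr_wpDl.
have dA : A * d <= 2^-1.
  apply: (@le_trans _ _ ((A + 1) * (2 * (A + 1))^-1)).
    by rewrite ler_pM ?(ltW d0)// ?lerDl// ge_min lexx orbT.
  by rewrite invfM mulrCA mulfV ?mulr1// gt_eqF// ltr_wpDl.
exists d => // T T0 wT.
have [M wM] := w_bounded (T + d).
have M0 : 0 <= M.
  apply: le_trans (rnorm_ge0 _) (wM 0%N 0 _).
  by rewrite oppr_le0 ge0/= addr_ge0// ltW.
pose Q K := forall t, - h%:num <= t <= T + d ->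
  limsup_norm_le (fun m => rnorm (w m t)) K.
suff Qhalf K : 0 <= K -> Q K -> Q (K / 2).
  (* The iteration starts from the uniform bound [M] at [k = 0]. *)
  have QM k : Q (M / 2 ^+ k).
    elim: k => [|k IH]; last first.
      by rewrite exprSr invfM mulrA; apply: Qhalf => //; rewrite divr_ge0// exprn_ge0.
    move=> t tT e e0; near=> m.
    rewrite ger0_norm ?rnorm_ge0// expr0 divr1 (le_trans (wM m _ tT))// lerDl.
    exact: ltW.
  by move=> t tT; apply: limsup_norm_le_inf => k; exact: QM.
move=> K0 QK t /andP[ht tTd].
have [tT|Tt] := leP t T.
  apply: limsup_norm_le_wr (wT t _); first by rewrite divr_ge0.
  by rewrite ht.
have t0 : 0 < t := le_lt_trans T0 Tt.
have segT s (r : segI h) : 0 <= s -> - h%:num <= s + I_val r <= s.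
  move=> s0; have /andP[hr r0] := I_val_itv r.
  by rewrite (le_trans hr) ?lerDr//= -[leRHS]addr0 lerD2l.
(* The summands belong to the value at 0, the initial [LE] term, the [LE] term at [t] and the
   integral; only the last need not tend to 0. *)
have cw k : limsup_norm_le (fun m => rnorm (Cn_coord N k (w m t)))
    (0 + 0 + 0 + (C k * K * (t - T) + C k * K * (t - T))).
  have [D D0 HD] := rnorm_coord N.
  have l1 : limsup_norm_le (fun m => rnorm (Cn_coord N k (w m 0))) 0.
    rewrite -[X in limsup_norm_le _ X](mulr0 D).
    apply: limsup_norm_leW (limsup_norm_leZ D0 (wT 0 _)) => [m|].
      rewrite ger0_norm ?rnorm_ge0//; apply: le_trans (HD (w m 0) k) _.
      exact: ler_norm.
    by rewrite oppr_le0 ge0 T0.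
  have l2 : limsup_norm_le (fun m => rnorm (LE (segment (w m) 0) (Cn_coord N k))) 0.
    apply: (Hd1 _ _ M) => [m|m s|s _]; first exact: w_A.
      apply: wM; have /andP[-> /le_trans] := segT 0 s (lexx _); apply.
      by rewrite addr_ge0// ltW.
    by apply: wT; have /andP[-> /le_trans] := segT 0 s (lexx _); exact.
  have l3 : limsup_norm_le (fun m => rnorm (LE (segment (w m) t) (Cn_coord N k))) 0.
    apply: (Hd1 _ _ M) => [m|m s|s sd]; first exact/w_A/ltW.
      by apply: wM; have /andP[-> /le_trans] := segT t s (ltW t0); exact.
    (* From [I_val s <= - d1], [t <= T + d] and [d <= d1] follows [t + I_val s <= T]. *)
    apply: wT; have /andP[-> _] /= := segT t s (ltW t0).
    have : d <= d1 by rewrite ge_min lexx.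
    by lra.
  have l4 : limsup_norm_le (fun m => rnorm (clebesgue_integral `]0, t[
      (fun s => RE (segment (w m) s) (Cn_coord N k))))
      (C k * K * (t - T) + C k * K * (t - T)).
    have [B HB] := extension_bounded extR (Cn_coord N k).
    apply: (limsup_clebesgue_integral (M := B * M)).
    - by rewrite T0.
    - by rewrite mulr_ge0.
    - by move=> m; have [] := w_eq m k t0.
    - move=> m s /andP[s0 st]; apply: HB; first exact/w_A/ltW.
      move=> r; apply: wM; have /andP[-> /le_trans] := segT s r (ltW s0); apply.
      by rewrite (le_trans (ltW st)).
    - move=> s /andP[s0 sT]; rewrite -(mulr0 (C k)); apply: (HC k _ M) => //.
      + by move=> m; exact/w_A/ltW.
      + move=> m r; apply: wM; have /andP[-> /le_trans] := segT s r (ltW s0); apply.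
        by rewrite (le_trans sT)// lerDl ltW.
      + by move=> r; apply: wT; have /andP[-> /le_trans] := segT s r (ltW s0); exact.
    - move=> s /andP[s0 st]; apply: (HC k _ M) => //.
      + by move=> m; exact/w_A/ltW.
      + move=> m r; apply: wM; have /andP[-> /le_trans] := segT s r (ltW s0); apply.
        by rewrite (le_trans (ltW st)).
      + move=> r; apply: QK; have /andP[-> /le_trans] := segT s r (ltW s0); apply.
        by rewrite (le_trans (ltW st)).
  apply: limsup_norm_leW
    (limsup_norm_leD (limsup_norm_leD (limsup_norm_leD l1 l2) l3) l4) => m.
  rewrite ger0_norm ?rnorm_ge0// [leRHS]ger0_norm ?addr_ge0 ?rnorm_ge0//.
  have [_ E] := w_eq m k t0.
  have -> : Cn_coord N k (w m t) =
      Cn_coord N k (w m 0) - LE (segment (w m) 0) (Cn_coord N k)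
      + LE (segment (w m) t) (Cn_coord N k) +
      clebesgue_integral `]0, t[ (fun s => RE (segment (w m) s) (Cn_coord N k)).
    by rewrite addrAC -E subrK.
  rewrite (le_trans (rnormD _ _))// lerD2r (le_trans (rnormD _ _))// lerD2r.
  by rewrite (le_trans (rnormD _ _))// rnormN.
have := limsup_norm_le_sum (fun k => limsup_norm_leZ (rnorm_ge0 (e_ N k)) (cw k)).
have -> : \sum_k rnorm (e_ N k) * (0 + 0 + 0 +
    (C k * K * (t - T) + C k * K * (t - T))) = A * (t - T) * K.
  by rewrite /A !mulr_suml; apply: eq_bigr => k _; ring.
move=> H; apply: limsup_norm_le_wr; last first.
  apply: limsup_norm_leW H => m; rewrite ger0_norm ?rnorm_ge0//.
  by rewrite (le_trans (rnorm_le_coord _))// ler_norm.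
rewrite [leRHS]mulrC ler_wpM2r// (le_trans _ dA)// ler_wpM2l//.
by rewrite lerBlDl.
Unshelve. all: by end_near. Qed.

(** The step length [d] is the same for all [T], so finitely many steps reach any given time. *)
Lemma limsup_solution0 : w_to0 0 -> forall t, - h%:num <= t ->
  limsup_norm_le (fun m => rnorm (w m t)) 0.
Proof.
move=> w0 t ht; have [d d0 Hd] := w_to0_step.
have H i : w_to0 (i%:R * d).
  elim: i => [|i IH]; first by rewrite mul0r.
  rewrite -natr1 mulrDl mul1r; apply: Hd => //.
  by rewrite mulr_ge0// ltW.
apply: (H (Num.bound `|t / d|)); rewrite ht /= -ler_pdivrMr//.
exact: le_trans (ler_norm _) (ltW (archi_boundP (normr_ge0 _))).
Qed.

End convergence.

(** Agreement of [k] with the difference is asked on [J] only, since segments are controlled at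
    nonnegative times only. *)
Lemma clebesgue_integralB (R : realType) (J : set R) (f g k : R -> R[i]) :
  measurable (J : set (measurableTypeR R)) ->
  clebesgue_integrable J f -> clebesgue_integrable J g ->
  (forall s, J s -> k s = f s - g s) ->
  clebesgue_integrable J k /\
  clebesgue_integral J k = clebesgue_integral J f - clebesgue_integral J g.
Proof.
move=> mJ [fRe fIm] [gRe gIm] kE.
have kRe s : s \in J -> complex.Re (f s) - complex.Re (g s) = complex.Re (k s).
  by rewrite inE => Js; rewrite kE// raddfB.
have kIm s : s \in J -> complex.Im (f s) - complex.Im (g s) = complex.Im (k s).
  by rewrite inE => Js; rewrite kE// raddfB.
split.
  split.
    apply: (eq_integrable mJ _ _ _ (integrableB mJ fRe gRe)) => s Js.
    by rewrite -kRe.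
  apply: (eq_integrable mJ _ _ _ (integrableB mJ fIm gIm)) => s Js.
  by rewrite -kIm.
rewrite /clebesgue_integral.
have -> : \int[lebesgue_measure]_(s in J) complex.Re (k s) =
    \int[lebesgue_measure]_(s in J) (complex.Re (f s) - complex.Re (g s)).
  by apply: eq_Rintegral => s Js; rewrite kRe.
have -> : \int[lebesgue_measure]_(s in J) complex.Im (k s) =
    \int[lebesgue_measure]_(s in J) (complex.Im (f s) - complex.Im (g s)).
  by apply: eq_Rintegral => s Js; rewrite kIm.
by rewrite !RintegralB.
Qed.

(** * Continuous approximation of the discontinuous initial values *)

Section ramp.
Context (R : realType) (n : nat) (h : {posnum R}) (N : vnorm R n) (j : 'I_n).

Definition ramp_fun (m : nat) (s : segI h) : R :=
  Num.max 0 (1 + m%:R * I_val s).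

Lemma ramp_fun_continuous m : continuous (ramp_fun m).
Proof.
move=> s; suff : {for s, continuous ((cst 0 : segI h -> R^o) \max
    (fun s => 1 + m%:R * I_val s : R^o))} by [].
apply: continuous_max; first exact: cst_continuous.
apply: continuousD; first exact: cst_continuous.
by apply: continuousM; [exact: cst_continuous|exact: I_val_continuous].
Qed.

Lemma ramp_fun_itv m s : 0 <= ramp_fun m s <= 1.
Proof.
rewrite le_max lexx ge_max ler01 /= gerDl mulr_ge0_le0//.
by have /andP[] := I_val_itv s.
Qed.

Lemma ramp_subproof m :
  (fun s => (ramp_fun m s)%:C%C *: e_ N j) \in cts_pred h (Cn N).
Proof.
apply/asboolP; apply: continuous_realZ (@ramp_fun_continuous m) _.
exact: cst_continuous.
Qed.

Definition ramp m : cts h (Cn N) := Cts (ramp_subproof m).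

Lemma rnorm_ramp m : rnorm (e_ N j) <= 1 -> rnorm (ramp m) <= 1.
Proof.
move=> ej; rewrite rnorm_cts; apply: sup_le_nneg => // _ [s _ <-] /=.
have /andP[r0 r1] := ramp_fun_itv m s.
rewrite rnormZ rnorm_real ger0_norm// -[leRHS]mul1r.
by rewrite ler_pM ?rnorm_ge0.
Qed.

(** The two maps agree eventually at each point: at 0 always, and where [I_val s < 0] as soon as
    [m >= (- I_val s)^-1], when the ramp has reached 0. *)
Lemma limsup_ramp (s : segI h) :
  limsup_norm_le (fun m => rnorm (phi_ N j s - ramp m s)) 0.
Proof.
move=> e e0; rewrite /= /phi_ /ramp_fun; have [->|s0] := eqVneq (I_val s) 0.
  near=> m; rewrite mulr0 addr0 max_r// scale1r subrr rnorm0 normr0 add0r.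
  exact: ltW.
have {}s0 : I_val s < 0 by rewrite lt_neqAle s0; have /andP[] := I_val_itv s.
near=> m; rewrite max_l; first by rewrite scale0r subrr rnorm0 normr0 add0r ltW.
suff : (- I_val s)^-1 <= m%:R.
  by rewrite -div1r ler_pdivrMr ?oppr_gt0//; lra.
near: m; exact: nbhs_infty_ger.
Unshelve. all: by end_near. Qed.

End ramp.

Lemma I_val_surj (R : realType) (h : {posnum R}) (t : R) :
  - h%:num <= t <= 0 -> exists s : segI h, I_val s = t.
Proof.
move=> ht; have tI : t \in `[- h%:num, 0]%classic by rewrite inE /= in_itv.
by exists (exist _ t tI).
Qed.

(** * Transfer of the semigroup bound to the fundamental solution *)

Theorem corollary5p11 (R : realType) (n : nat) (h : {posnum R})
  (N : vnorm R n)
  (L Rop : lc (cts h (Cn N)) (Cn N))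
  (hDelta : condition_Delta L)
  (LE RE : (segI h -> Cn N) -> dual (dual (Cn N)))
  (hLE : is_extension L LE) (hRE : is_extension Rop RE)
  (S : R -> lc (cts h (Cn N)) (cts h (Cn N)))
  (hS : solution_semigroup L Rop S)
  (X : 'I_n -> R -> Cn N)
  (hX : fundamental_solution LE RE X)
  (c gamma : R) (hc : 0 <= c)
  (hbound : forall t : R, 0 <= t -> rnorm (S t) <= c * expR (gamma * t)) :
  forall j : 'I_n, rnorm (e_ N j) <= 1 ->
  forall t : R, 0 <= t -> rnorm (X j t) <= c * expR (gamma * t).
Proof.
move=> j ej t t0; have [y [y0 Ay Asy ey] ->] := hX j; rewrite ltNge t0 /=.
have /choice[v Hv] m : exists v, [/\ continuous v,
    neutral_solution L Rop (ramp h N j m) v &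
    forall s, 0 <= s -> S s (ramp h N j m) = csegment h v s].
  have [v0 sv0 Sv0] := hS (ramp h N j m).
  have [v [cv sv vv0]] := neutral_solution_continuous sv0.
  by exists v; split=> // s s0; rewrite Sv0// vv0.
have cv m : continuous (v m) by have [] := Hv m.
have y0E : segment y 0 = phi_ N j :> (segI h -> Cn N) by apply/funext.
have v0E m : segment (v m) 0 = ramp h N j m :> (segI h -> Cn N).
  by have [_ [_ <- _] _] := Hv m; rewrite csegmentE.
(* [v m s] is the value at 0 of the segment [S s (ramp h N j m)], and [ej] makes the norm of the
   ramp at most 1. *)
have vle m s : 0 <= s -> rnorm (v m s) <= c * expR (gamma * s).
  move=> s0; have -> : v m s = csegment h (v m) s (I0 h).
    by rewrite csegmentE// /segment /I_val /= addr0.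
  apply: le_trans (cts_rnorm_ub _ _) _; have [_ _ <-//] := Hv m.
  apply: le_trans (opnorm_ub (S s) (ramp h N j m)) _.
  rewrite -[leRHS]mulr1; apply: ler_pM; first exact: opnorm_ge0.
  - exact: rnorm_ge0.
  - exact: hbound.
  - exact: rnorm_ramp.
pose w m s : Cn N := y s - v m s.
have w0 s : - h%:num <= s <= 0 -> limsup_norm_le (fun m => rnorm (w m s)) 0.
  move=> /(@I_val_surj R h)[r rs]; apply: limsup_norm_leW (limsup_ramp N j r) => m.
  by rewrite -y0E -v0E /segment add0r rs.
have w_bounded (T : R) : exists M : R,
    forall m s, - h%:num <= s <= T -> rnorm (w m s) <= M.
  (* The maximum with [- h] keeps the interval nonempty when [T < - h]. *)
  have [My HMy] := property_A_rnorm_bounded (Ay (- h%:num)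
    (Num.max (- h%:num) T) (lexx _) (ltac:(by rewrite le_max lexx))).
  (* The 1 covers [v m] on [-h, 0], where it is the ramp; the exponential term covers [0, T] for
     either sign of [gamma]. *)
  exists (My + (1 + c * expR (`|gamma| * `|T|))) => m s /andP[hs sT].
  have sI : s \in `[- h%:num, Num.max (- h%:num) T]%classic.
    by rewrite inE /= in_itv/= hs le_max sT orbT.
  rewrite (le_trans (rnormD _ _))// rnormN lerD//; first exact: (HMy (exist _ s sI)).
  have [s0|s0] := leP 0 s.
    rewrite (le_trans (vle _ _ s0))// -[leLHS]add0r lerD// ler_wpM2l// ler_expR.
    rewrite (le_trans (ler_norm _))// normrM ler_pM//.
    by rewrite ger0_norm// (le_trans sT)// ler_norm.
  have /(@I_val_surj R h)[r rs] : - h%:num <= s <= 0 by rewrite hs ltW.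
  have -> : v m s = ramp h N j m r by rewrite -v0E /segment add0r rs.
  rewrite -[leLHS]addr0 lerD// ?mulr_ge0// ?expR_ge0//.
  by rewrite (le_trans (cts_rnorm_ub _ _))// rnorm_ramp.
have w_A m s : 0 <= s -> property_A (segment (w m) s : segI h -> Cn N).
  by move=> s0; apply: property_AB; [exact: Asy|exact: segment_property_A].
have extB LamE (Lam : lc (cts h (Cn N)) (Cn N)) ys m s : is_extension Lam LamE ->
    0 <= s -> LamE (segment (w m) s) ys =
      LamE (segment y s) ys - ys (Lam (csegment h (v m) s)).
  move=> ext s0; rewrite -(extension_segment ext)//.
  by rewrite -(extensionB ext)//; [exact: Asy|exact: segment_property_A].
have w_eq m k (s : R) : 0 < s ->
  clebesgue_integrable `]0, s[ (fun r => RE (segment (w m) r) (Cn_coord N k)) /\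
  Cn_coord N k (w m s) - LE (segment (w m) s) (Cn_coord N k) =
    Cn_coord N k (w m 0) - LE (segment (w m) 0) (Cn_coord N k) +
    clebesgue_integral `]0, s[ (fun r => RE (segment (w m) r) (Cn_coord N k)).
  move=> s0; have [G /(_ (Cn_coord N k))[iy GE] yE] := ey s s0.
  have [_ sv _] := Hv m.
  have [iv vE] := neutral_solution_integral hLE hRE (Cn_coord N k) (cv m) sv s0.
  have wE r : `]0, s[%classic r -> RE (segment (w m) r) (Cn_coord N k) =
      RE (segment y r) (Cn_coord N k) - Cn_coord N k (Rop (csegment h (v m) r)).
    by rewrite /= in_itv/= => /andP[r0 _]; apply: extB => //; exact: ltW.
  have [iw ->] := clebesgue_integralB (measurable_itv _) iy iv wE.
  split => //; rewrite (extB _ _ _ _ _ hLE (ltW s0)) (extB _ _ _ _ _ hLE (lexx 0)).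
  (* The equation in the bidual is evaluated at [Cn_coord N k], where the weak-star integral becomes
     a Lebesgue integral. *)
  have {}yE : Cn_coord N k (y s) - LE (segment y s) (Cn_coord N k) =
      Cn_coord N k (y 0) - LE (segment y 0) (Cn_coord N k) +
      clebesgue_integral `]0, s[ (fun r => RE (segment y r) (Cn_coord N k)).
    rewrite -GE y0E.
    have -> : y 0 = phi_ N j (I0 h) by rewrite -y0E /segment /I_val /= addr0.
    exact: (congr1 (fun F : dual (dual (Cn N)) => F (Cn_coord N k)) yE).
  have wB r : Cn_coord N k (w m r) = Cn_coord N k (y r) - Cn_coord N k (v m r).
    exact: linearB.
  have comb (A B C D I A' B' C' D' I' : R[i]) : A - B = C - D + I ->
      A' - B' = C' - D' + I' -> A - A' - (B - B') = C - C' - (D - D') + (I - I').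
    move=> e1 e2; have -> : A - A' - (B - B') = (A - B) - (A' - B') by ring.
    by rewrite e1 e2; ring.
  have [_ v0p _] := sv; rewrite v0p !wB; exact: comb yE vE.
have wlim := limsup_solution0 hDelta hLE hRE w_bounded w_A w_eq w0.
(* For every [m], |y t| - c e^(gamma t) is at most |w m t|, and the latter tends to 0. *)
rewrite -subr_le0; apply: limsup_norm_le_cst (wlim t _) _ => [|m].
  by rewrite (le_trans _ t0)// oppr_le0.
rewrite (le_trans _ (ler_norm _))// lerBlDr.
rewrite -(subrK (v m t) (y t)) (le_trans (rnormD _ _))// lerD2l; exact: vle.
Qed.
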